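(* Let $(\mathfrak{g},J)$ be MaxN, where $\nu(\mathfrak{g})=3$ and $\dim_{\mathbb{C}}\mathfrak{g}=n\ge5$. Then: (1) If $n-2\in\mathrm{Dpt}(J)$, then for each $3\le k\le n-2$, $k\in\mathrm{Dpt}(J)\iff k\equiv n-2\pmod 2$. (2) If $n-2\notin\mathrm{Dpt}(J)$, then for each $3\le k\le n-2$, $k\in\mathrm{Dpt}(J)\iff k\not\equiv n-2\pmod 2$. Moreover, there exists an admissible coframe $\{\omega^k\}_{k=1}^n$ such that $d\omega^1=0$, $d\omega^2=\omega^1\wedge\overline{\omega}^1$, and for each $3\le k\le n-2$, $$k\notin\mathrm{Dpt}(J)\iff\omega^k\in V^2_{\mathbb{C}},\qquad k\in\mathrm{Dpt}(J)\iff\omega^k\in V^3_{\mathbb{C}}\setminus V^2_{\mathbb{C}}.$$ Furthermore, for this coframe and for $a_k,b_k\in\mathbb{C}$ ($1\le k\le n-2$), $$\sum_{k=1}^{n-2}(a_k\omega^k+b_k\overline{\omega}^k)\in V^2_{\mathbb{C}}\iff a_k=b_k\ \text{ for all } k\in\mathrm{Dpt}(J)\text{ with }3\le k\le n-2.$$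
   Context: Lie algebras are real, of finite positive dimension. $\nu(\mathfrak{g})$ is the nilpotency step of $\mathfrak{g}$ (smallest $s$ with $\mathfrak{g}^s=0$, where $\mathfrak{g}^0=\mathfrak{g}$, $\mathfrak{g}^k=[\mathfrak{g}^{k-1},\mathfrak{g}]$). A complex structure on $\mathfrak{g}$ is a linear endomorphism $J:\mathfrak{g}\to\mathfrak{g}$ with $J^2=-1$ and $[JX,JY]=J[JX,Y]+J[X,JY]+[X,Y]$ for all $X,Y\in\mathfrak{g}$; $\dim_{\mathbb{C}}\mathfrak{g}=\frac12\dim_{\mathbb{R}}\mathfrak{g}$. $\mathfrak{g}^{1,0}$ is the $\sqrt{-1}$-eigenspace of $J$ acting on $\mathfrak{g}^*_{\mathbb{C}}=\mathfrak{g}^*\otimes_{\mathbb{R}}\mathbb{C}$ by $(J\alpha)(X)=\alpha(JX)$. $d$ is the Chevalley–Eilenberg differential, $d\alpha(X,Y)=-\alpha([X,Y])$, extended complex-linearly. Put $V^0=0$, $V^k=\{\alpha\in\mathfrak{g}^* : d\alpha\in\bigwedge^2V^{k-1}\}$ for $k\ge1$, and $V^k_{\mathbb{C}}=V^k\otimes_{\mathbb{R}}\mathbb{C}$. Put $\mathfrak{a}_0=0$ and $\mathfrak{a}_k=\{X\in\mathfrak{g} : [X,\mathfrak{g}]\subseteq\mathfrak{a}_{k-1},\ [JX,\mathfrak{g}]\subseteq\mathfrak{a}_{k-1}\}$ for $k\ge1$. $J$ is nilpotent if $\mathfrak{a}_t=\mathfrak{g}$ for some $t$, and then $\nu(J)$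 is the smallest such $t$. $(\mathfrak{g},J)$ is MaxN if $\mathfrak{g}$ is nilpotent and $J$ is a nilpotent complex structure with $\nu(J)=\dim_{\mathbb{C}}\mathfrak{g}$. An admissible coframe of a MaxN pair is a basis $\{\omega^k\}_{k=1}^n$ of $\mathfrak{g}^{1,0}$ such that $$d\omega^k=\sum_{i<j<k}A_{ij}^k\,\omega^i\wedge\omega^j+\sum_{i,j<k}B_{ij}^k\,\omega^i\wedge\overline{\omega}^j,\qquad 1\le k\le n,$$ where for each $2\le k\le n$ the coefficients $\{A_{i,k-1}^k\}_{i<k-1}$, $\{B_{k-1,j}^k\}_{j=1}^{k-1}$, $\{B_{i,k-1}^k\}_{i<k-1}$ are not all zero, and each $\omega^k$ satisfies one of: (D) $d\omega^k+d\overline{\omega}^k=0$; (I) for $a,b\in\mathbb{C}$, $a\,d\omega^k+b\,d\overline{\omega}^k\in\mathrm{span}_{\mathbb{C}}\{d\omega^{j},d\overline{\omega}^{j} : 1\le j\le k-1\}$ if and only if $a=b=0$. Admissible coframes exist for every MaxN pair, and $\mathrm{Dpt}(J)=\{1\le i\le n : \omega^i\text{ satisfies (D)}\}$ does not depend on the choice of admissible coframe. *)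

(* Defs.v *)
From HB Require Import structures.
From mathcomp Require Import all_boot all_order all_algebra.
From mathcomp Require Import all_classical reals.
From mathcomp Require Import complex.

Set Implicit Arguments.
Unset Strict Implicit.
Unset Printing Implicit Defensive.

Import Order.TTheory GRing.Theory Num.Theory.

Local Open Scope classical_set_scope.
Local Open Scope ring_scope.

HB.mixin Record Vector_isLieAlgebra (K : fieldType) (g : Type)
    of Vector K g := {
  br : g -> g -> g;
  br_linearl : forall y, linear (br^~ y);
  br_linearr : forall x, linear (br x);
  br_alt : forall x, br x x = 0;
  br_jacobi : forall x y z,
    br x (br y z) + br y (br z x) + br z (br x y) = 0
}.

#[short(type="lieAlgType")]
HB.structure Definition LieAlgebra (K : fieldType) :=
  {g of Vector K g & Vector_isLieAlgebra K g}.

Definition is_least (P : set nat) (n : nat) : Prop :=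
  P n /\ forall m, P m -> (n <= m)%N.

Definition span_set (K : fieldType) (V : lmodType K) (A : set V) : set V :=
  [set v | exists (m : nat) (c : 'I_m -> K) (w : 'I_m -> V),
     (forall i, A (w i)) /\ v = \sum_i c i *: w i].

Section Forms.
Variables (R : realType) (g : lieAlgType R).

Fixpoint lcs (k : nat) : set g :=
  if k is k'.+1 then
    span_set [set Z | exists X Y : g, lcs k' X /\ Z = br X Y]
  else setT.

Definition lie_nilpotent : Prop := exists s, lcs s = [set 0].

Definition is_lie_step (s : nat) : Prop := is_least [set s | lcs s = [set 0]] s.

(* The division is exact when g carries a complex structure. *)
Definition dimC : nat := (\dim {: g})./2.

(* A 2-form with values in K is an alternating map g -> g -> K. *)
Definition wedge (K : pzRingType) (al be : g -> K) : g -> g -> K :=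
  fun X Y => al X * be Y - al Y * be X.

Definition dCE (K : zmodType) (al : g -> K) : g -> g -> K :=
  fun X Y => - al (br X Y).

Fixpoint Vk (k : nat) : set 'Hom(g, R^o) :=
  if k is k'.+1 then
    [set al | span_set
       [set eta | exists be ga : 'Hom(g, R^o),
          [/\ Vk k' be, Vk k' ga & eta = wedge be ga]]
       (dCE al : g -> g -> R^o)]
  else [set 0].

(* An element be + i ga of V (x)_R C is identified with the R-linear map
   X |-> be X + i ga X from g to R[i]. *)
Definition VkC (k : nat) : set (g -> R[i]) :=
  [set al | exists be ga : 'Hom(g, R^o),
     [/\ Vk k be, Vk k ga & forall X, al X = (be X +i* ga X)%C]].

Definition fbar (al : g -> R[i]) : g -> R[i] := fun X => conjc (al X).

Section ComplexStructure.
Variable J : 'End(g).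

Definition complex_structure : Prop :=
  (forall X, J (J X) = - X) /\
  (forall X Y, br (J X) (J Y) = J (br (J X) Y) + J (br X (J Y)) + br X Y).

(* Rcomplex R is R[i] as a vector space over R. *)
Definition g10 : set (g -> R[i]) :=
  [set al | linear (al : g -> Rcomplex R) /\
            forall X, al (J X) = 'i%C * al X].

Fixpoint ak (k : nat) : set g :=
  if k is k'.+1 then
    [set X | forall Y, ak k' (br X Y) /\ ak k' (br (J X) Y)]
  else [set 0].

Definition nilpotent_J : Prop := exists t, ak t = setT.

Definition is_step_J (t : nat) : Prop := is_least [set t | ak t = setT] t.

Definition MaxN : Prop :=
  [/\ lie_nilpotent, complex_structure, nilpotent_J & is_step_J dimC].

(* Coframes are indexed by 1 <= k <= dimC; other values of om are unused. *)
Definition basis10 (om : nat -> g -> R[i]) : Prop :=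
  [/\ forall k, (1 <= k <= dimC)%N -> g10 (om k),
      forall c : nat -> R[i],
        \sum_(1 <= k < dimC.+1) c k *: om k = 0 ->
        forall k, (1 <= k <= dimC)%N -> c k = 0
    & forall al, g10 al ->
        exists c : nat -> R[i], al = \sum_(1 <= k < dimC.+1) c k *: om k].

Definition condD (om : nat -> g -> R[i]) (k : nat) : Prop :=
  dCE (om k) + dCE (fbar (om k)) = 0.

Definition condI (om : nat -> g -> R[i]) (k : nat) : Prop :=
  forall a b : R[i],
    span_set [set eta : g -> g -> R[i] | exists j, (1 <= j <= k.-1)%N /\
                (eta = dCE (om j) \/ eta = dCE (fbar (om j)))]
             (a *: dCE (om k) + b *: dCE (fbar (om k)))
    <-> a = 0 /\ b = 0.

(* A k i j and B k i j stand for A_{ij}^k and B_{ij}^k. *)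
Definition admissible (om : nat -> g -> R[i]) : Prop :=
  basis10 om /\
  exists A B : nat -> nat -> nat -> R[i],
    [/\ forall k, (1 <= k <= dimC)%N ->
          dCE (om k) =
            \sum_(1 <= j < k) \sum_(1 <= i < j) A k i j *: wedge (om i) (om j)
            + \sum_(1 <= i < k) \sum_(1 <= j < k)
                B k i j *: wedge (om i) (fbar (om j)),
        forall k, (2 <= k <= dimC)%N ->
          [\/ exists i, (1 <= i < k.-1)%N /\ A k i k.-1 <> 0,
              exists j, (1 <= j <= k.-1)%N /\ B k k.-1 j <> 0
            | exists i, (1 <= i < k.-1)%N /\ B k i k.-1 <> 0]
      & forall k, (1 <= k <= dimC)%N -> condD om k \/ condI om k].

(* For MaxN pairs admissible coframes exist and whether the k-th member
   satisfies (D) does not depend on the coframe, so that quantifying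
   existentially or universally over coframes gives the same set. *)
Definition Dpt : set nat :=
  [set k | (1 <= k <= dimC)%N /\ exists om, admissible om /\ condD om k].

End ComplexStructure.
End Forms.

Arguments lcs {R} g k.
Arguments lie_nilpotent {R} g.
Arguments is_lie_step {R} g s.
Arguments dimC {R} g.
Arguments Vk {R} g k.
Arguments VkC {R} g k.

(* Main.v *)
Require Import Defs.
From HB Require Import structures.
From mathcomp Require Import all_boot all_order all_algebra.
From mathcomp Require Import all_classical reals.
From mathcomp Require Import complex ring lra zify.

(** Let F k = a_(n-k). Maximality of the step of J forces dim F k = 2(n - k),
    so F is a descending flag of J-stable ideals whose quotients F k / F (k+1)
    are complex lines; here the k-th line means F k / F (k+1). In any
    admissible coframe the first k members cut out F k
    ([admissible_adapted]), hence everything can be read on the flag. Write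
    L 1 = [g,g] and L 2 = [L 1,g], which is central because the step is 3.
    A form omega^(k+1) can be normalized to satisfy (D) exactly when L 1 does
    not cover the k-th line, since (D) says that the real part of omega^(k+1)
    kills L 1 ([DptP]).

    The heart is [adJ_onto]: if Z is nonzero in the j-th line and [Z,g] falls
    into F (j+2), integrability makes the map Y |-> [JZ,Y] to the next line
    commute with J, so that it is onto. It is applied with Z in L 2, where
    [Z,g] = 0, and with Z in L 1, where [Z,g] lies in L 2. Moreover L 2 never
    covers a line except possibly the last one, being central. The outcome is
    that, as long as two more lines follow and past the first two lines, L 1
    covers a line exactly when L 2 misses it, and then L 1 covers neither of
    its two neighbours; if L 1 does not cover a line then it covers the next
    one ([covers_alternate]). This is the alternation of (D), hence the parity
    statements.

    As V^k is the annihilator of the k-th term of the lower central series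
    ([VkP]), membership in V^2 means vanishing on L 2. For k outside Dpt one
    needs a (1,0)-form leading at the (k-1)-st line and killing L 2, thus also
    J L 2; it exists because L 2 and J L 2 are independent modulo the flag
    ([lcs2_J_independent]), which follows again from L 2 not covering lines.
    For k in Dpt, L 2 meets the line, so omega^k cannot kill it, whereas
    omega^k + conj omega^k does. Testing a combination on these vectors of
    L 2, from the top index down, gives the last equivalence. *)

Set Implicit Arguments.
Unset Strict Implicit.
Unset Printing Implicit Defensive.

Import Order.TTheory GRing.Theory Num.Theory.

Local Open Scope ring_scope.

(** * Subspaces, spans and separating functionals *)

Definition subspace (K : fieldType) (V : lmodType K) (P : set V) : Prop :=
  P 0 /\ forall a x y, P x -> P y -> P (a *: x + y).

Section LinearAlgebra.
Variables (K : fieldType) (V : vectType K).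
Implicit Types (U : {vspace V}) (P : set V).

(** A subspace of largest dimension inside P must be all of P. *)
Lemma subspace_vspace P :
  subspace P -> exists U : {vspace V}, forall x, (x \in U) <-> P x.
Proof.
case=> P0 Plin.
pose Q d := `[< exists U : {vspace V}, \dim U = d /\ forall x, x \in U -> P x >].
have exQ : exists d, Q d.
  exists 0%N; apply/asboolP; exists 0%VS; split; first by rewrite dimv0.
  by move=> x; rewrite memv0 => /eqP ->.
have ubQ d : Q d -> (d <= \dim {: V})%N.
  by move/asboolP=> [U [<- _]]; apply: dimvS; apply: subvf.
case: (ex_maxnP exQ ubQ) => d /asboolP[U [dU UP]] maxd.
exists U => x; split; first exact: UP.
move=> Px; apply/negPn/negP => xU.
have : Q (\dim (U + <[x]>)).
  apply/asboolP; exists (U + <[x]>)%VS; split=> // y.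
  case/memv_addP=> u uU [v /vlineP[a ->] ->]; rewrite addrC.
  by apply: Plin => //; apply: UP.
move/maxd; rewrite -dU => le_d.
have sub : (U <= U + <[x]>)%VS by apply: addvSl.
have /eqP eqU : U == (U + <[x]>)%VS by rewrite eqEdim sub le_d.
by case/negP: xU; rewrite eqU; apply: (subvP (addvSr _ _)); apply: memv_line.
Qed.

(** The value 0 is a default, taken when P is not a subspace. *)
Definition vspace_of P : {vspace V} :=
  xget 0%VS [set U : {vspace V} | forall x, (x \in U) <-> P x]%classic.

Lemma mem_vspace_of P : subspace P -> forall x, (x \in vspace_of P) <-> P x.
Proof.
move/subspace_vspace=> [U PU]; rewrite /vspace_of.
by case: xgetP => [W _|/(_ U)].
Qed.

(** The coordinates of the projection onto a complement of U are functionals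
    vanishing on U which separate the classes modulo U. *)
Lemma coordinates_mod U :
  exists (m : nat) (e : 'I_m -> V) (x : 'I_m -> 'Hom(V, K^o)),
    (forall i u, u \in U -> x i u = 0) /\
    forall v, v - \sum_i x i v *: e i \in U.
Proof.
pose b := vbasis (U^C)%VS; pose p := daddv_pi (U^C)%VS U.
have capU : (U^C :&: U = 0)%VS by rewrite capvC capv_compl.
have lin i : linear (fun v => coord b i (p v) : K^o).
  by move=> a u v; rewrite !linearP.
pose h i : {linear V -> K^o} := HB.pack (fun v => coord b i (p v) : K^o)
  (GRing.isLinear.Build _ _ _ _ _ (lin i)).
exists _, (fun i => b`_i), (fun i => linfun (h i)); split.
  move=> i u uU; rewrite lfunE /=.
  suff -> : p u = 0 by rewrite linear0.
  have := daddv_pi_add capU (_ : u \in (U^C + U)%VS).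
  rewrite addvC addv_complf memvf => /(_ isT).
  rewrite (daddv_pi_id _ uU) ?capv_compl //.
  by move/(congr1 (fun w => w - u)); rewrite addrK subrr.
move=> v.
have := daddv_pi_add capU (_ : v \in (U^C + U)%VS).
rewrite addvC addv_complf memvf => /(_ isT) ev.
rewrite -[v in v - _]ev -/p {1}(coord_vbasis (memv_pi (U^C)%VS U v)).
rewrite addrAC (eq_bigr (fun i => linfun (h i) v *: b`_i)).
  by rewrite subrr add0r; apply: memv_pi.
by move=> i _; rewrite lfunE.
Qed.

Lemma separating_functional U v : v \notin U ->
  exists f : 'Hom(V, K^o), (forall u, u \in U -> f u = 0) /\ f v != 0.
Proof.
move=> vU; case: (coordinates_mod U) => m [e [x [x0 xv]]].
have [i xi | x_v0] := pickP (fun i => x i v != 0).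
  by exists (x i); split=> //; apply: x0.
case/negP: vU; have := xv v; rewrite big1 ?subr0 // => i _.
by rewrite (eqP (negbFE (x_v0 i))) scale0r.
Qed.

Lemma subspace_kernel (f : 'Hom(V, K^o)) : subspace [set v | f v = 0]%classic.
Proof.
split=> [|a x y]; first exact: linear0.
by move=> /= x0 y0; rewrite linearD linearZ /= x0 y0 scaler0 addr0.
Qed.
End LinearAlgebra.

Section Span.
Variables (K : fieldType) (V : lmodType K) (A : set V).

Lemma subspace_span : subspace (span_set A).
Proof.
split; first by exists 0%N, (fun=> 0), (fun=> 0); split; [case | rewrite big_ord0].
move=> a x y [m [c [w [Aw ->]]]] [m' [c' [w' [Aw' ->]]]].
exists (m + m')%N,
  (fun i : 'I_(m + m') =>
     match fintype.split i with inl j => a * c j | inr j => c' j end),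
  (fun i : 'I_(m + m') =>
     match fintype.split i with inl j => w j | inr j => w' j end); split.
  by move=> i; case: (fintype.split i).
rewrite big_split_ord /= scaler_sumr; congr (_ + _); apply: eq_bigr => i _.
  by rewrite (unsplitK (inl i)) scalerA.
by rewrite (unsplitK (inr i)).
Qed.

Lemma mem_span x : A x -> span_set A x.
Proof.
by move=> Ax; exists 1%N, (fun=> 1), (fun=> x); rewrite big_ord1 scale1r.
Qed.

Lemma subspace_sum (P : set V) (I : Type) (r : seq I) (c : I -> K) (w : I -> V) :
  subspace P -> (forall i, P (w i)) -> P (\sum_(i <- r) c i *: w i).
Proof.
move=> [P0 Plin] Pw; elim: r => [|i r IH]; first by rewrite big_nil.
by rewrite big_cons; apply: Plin.
Qed.

Lemma span_sub (P : set V) x :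
  subspace P -> (forall y, A y -> P y) -> span_set A x -> P x.
Proof.
by move=> sP AP [m [c [w [Aw ->]]]]; apply: subspace_sum => // i; apply: AP.
Qed.
End Span.

(** * Brackets and the lower central series *)

Section Bracket.
Variables (K : fieldType) (g : lieAlgType K).
Implicit Types X Y Z : g.

Lemma brDl X Y Z : br (X + Y) Z = br X Z + br Y Z.
Proof. by have := br_linearl Z 1 X Y; rewrite !scale1r. Qed.

Lemma br0l Z : br 0 Z = 0.
Proof. by apply: (addrI (br 0 Z)); rewrite -brDl !addr0. Qed.

Lemma brZl a X Z : br (a *: X) Z = a *: br X Z.
Proof. by have := br_linearl Z a X 0; rewrite br0l !addr0. Qed.

Lemma brNl X Z : br (- X) Z = - br X Z.
Proof. by rewrite -scaleN1r brZl scaleN1r. Qed.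

Lemma brC X Y : br X Y = - br Y X.
Proof.
have := br_alt (X + Y); rewrite brDl.
have addr Z : br Z (X + Y) = br Z X + br Z Y.
  by have := br_linearr Z 1 X Y; rewrite !scale1r.
by rewrite !addr !br_alt add0r addr0 => /eqP; rewrite addr_eq0 => /eqP.
Qed.

Lemma brDr X Y Z : br Z (X + Y) = br Z X + br Z Y.
Proof. by rewrite brC brDl opprD -!(brC Z). Qed.

Lemma brZr a X Z : br Z (a *: X) = a *: br Z X.
Proof. by rewrite brC brZl -scalerN -brC. Qed.

Lemma br_suml (I : Type) (r : seq I) (F : I -> g) Y :
  br (\sum_(i <- r) F i) Y = \sum_(i <- r) br (F i) Y.
Proof. by apply: (big_morph (br^~ Y)) => [X Z|]; rewrite ?brDl ?br0l. Qed.

Lemma br_sumr (I : Type) (r : seq I) (F : I -> g) Y :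
  br Y (\sum_(i <- r) F i) = \sum_(i <- r) br Y (F i).
Proof.
by apply: (big_morph (br Y)) => [X Z|]; rewrite ?brDr // brC br0l oppr0.
Qed.
End Bracket.

Section LowerCentralSeries.
Variables (R : realType) (g : lieAlgType R).
Implicit Types X Y Z : g.
Local Notation L k := (vspace_of (lcs g k)).

Lemma subspace_lcs k : subspace (lcs g k).
Proof. by case: k => [|k]; [split | apply: subspace_span]. Qed.

Lemma mem_lcs k X : X \in L k <-> lcs g k X.
Proof. exact/mem_vspace_of/subspace_lcs. Qed.

Lemma mem_lcs0 X : X \in L 0. Proof. exact/mem_lcs. Qed.

Lemma br_lcs k X Y : X \in L k -> br X Y \in L k.+1.
Proof. by move=> /mem_lcs Xk; apply/mem_lcs/mem_span; exists X, Y. Qed.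

Lemma lcs_ind k (P : set g) : subspace P ->
  (forall X Y, X \in L k -> P (br X Y)) -> forall X, X \in L k.+1 -> P X.
Proof.
move=> sP PL X /mem_lcs /(span_sub sP); apply => _ [Y [Z [/mem_lcs Yk ->]]].
exact: PL.
Qed.

Lemma subspace_mem (U : {vspace g}) : subspace [set X | X \in U]%classic.
Proof. by split=> [|a x y xU yU] /=; rewrite ?mem0v // memvD ?memvZ. Qed.

Lemma lcs_desc k X : X \in L k.+1 -> X \in L k.
Proof.
elim: k X => [|k IH] X; first by move=> _; apply: mem_lcs0.
apply: (lcs_ind (subspace_mem _)) => Y Z /IH; exact: br_lcs.
Qed.
End LowerCentralSeries.

(** * The flag of complex lines *)

(** The properties of the flag F k = a_(n-k) from which everything else is
    derived. [flag_lift] is the recursion that defines a_k, and [flag_line]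
    says that F k / F (k+1) is a complex line. *)
Record complex_flag (R : realType) (g : lieAlgType R) (J : 'End(g)) (n : nat)
    (F : nat -> {vspace g}) : Prop := ComplexFlag {
  flag_top : forall X, X \in F 0%N;
  flag_bot : forall X, X \in F n -> X = 0;
  flag_desc : forall k X, X \in F k.+1 -> X \in F k;
  flag_J : forall k X, X \in F k -> J X \in F k;
  flag_br : forall k X Y, (k < n)%N -> X \in F k -> br X Y \in F k.+1;
  flag_lift : forall k X, (k < n)%N ->
    (forall Y, br X Y \in F k.+1 /\ br (J X) Y \in F k.+1) -> X \in F k;
  flag_strict : forall k, (k < n)%N -> exists2 X, X \in F k & X \notin F k.+1;
  flag_line : forall k X Y, (k < n)%N -> X \in F k -> X \notin F k.+1 ->
    Y \in F k -> exists p q, Y - (p *: X + q *: J X) \in F k.+1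
}.

Section Flag.
Variables (R : realType) (g : lieAlgType R) (J : 'End(g)) (n : nat).
Variables (F : nat -> {vspace g}).
Hypothesis cJ : complex_structure J.
Hypothesis flagF : complex_flag J n F.
Implicit Types X Y Z : g.

Lemma complex_structureK X : J (J X) = - X. Proof. by case: cJ => H _. Qed.

Lemma flag_le i j X : (i <= j)%N -> X \in F j -> X \in F i.
Proof.
move=> /subnK <-; elim: (j - i)%N => [//|d IH].
by rewrite addSn => /(flag_desc flagF)/IH.
Qed.

(** J acts on g / U, where p + q J has inverse (p - q J) / (p^2 + q^2). *)
Lemma J_indep_mod (U : {vspace g}) p q X : (forall Y, Y \in U -> J Y \in U) ->
  X \notin U -> p *: X + q *: J X \in U -> p = 0 /\ q = 0.
Proof.
move=> JU XU pqU.
have Jpq : p *: J X - q *: X \in U.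
  by have := JU _ pqU; rewrite linearD !linearZ /= complex_structureK scalerN.
have : (p * p + q * q) *: X \in U.
  have -> : (p * p + q * q) *: X
      = p *: (p *: X + q *: J X) - q *: (p *: J X - q *: X).
    rewrite scalerDr scalerBr !scalerA (mulrC q p) opprB.
    by rewrite addrACA subrr addr0 scalerDl.
  by rewrite memvB ?memvZ.
have [/eqP | nz /(memvZ (p * p + q * q)^-1)] := eqVneq (p * p + q * q) 0.
  by rewrite paddr_eq0 ?sqr_ge0 // !mulf_eq0 !orbb => /andP[/eqP -> /eqP ->].
by rewrite scalerA mulVf // scale1r (negbTE XU).
Qed.

(** Once [Z,Y] vanishes in the next line, integrability reads
    [JZ,JY] = J[JZ,Y] there, so the image of ad JZ in that line is J-stable;
    it is nonzero, else Z would lie one step deeper, hence it is the whole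
    complex line. *)
Lemma adJ_onto j Z W : (j.+1 < n)%N -> Z \in F j -> Z \notin F j.+1 ->
  (forall Y, br Z Y \in F j.+2) -> W \in F j.+1 ->
  exists Y, W - br (J Z) Y \in F j.+2.
Proof.
move=> ltjn Zj Zj1 Z0 Wj.
have [Y0 Y0n] : exists Y, br (J Z) Y \notin F j.+2.
  apply: contrapT => no; case/negP: Zj1; apply: (flag_lift flagF ltjn) => Y.
  split=> //; apply/negPn/negP => nY; apply: no; by exists Y.
have JZj : br (J Z) Y0 \in F j.+1.
  by apply: (flag_br flagF _ (ltnW ltjn)); apply: (flag_J flagF).
have [p [q pq]] := flag_line flagF ltjn JZj Y0n Wj.
have JJZ : br (J Z) (J Y0) - J (br (J Z) Y0) \in F j.+2.
  have cancel (a b c : g) : a + b + c - a = b + c.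
    by rewrite addrAC [a + b]addrC addrK.
  by case: cJ => _ ->; rewrite cancel memvD //; apply: (flag_J flagF).
exists (p *: Y0 + q *: J Y0); rewrite brDr !brZr.
have := memvB pq (memvZ q JJZ); rewrite scalerBr !opprD opprK !addrA.
by rewrite [X in X \in _]addrAC addrNK.
Qed.

Local Notation L k := (vspace_of (lcs g k)).

Lemma lcs_flag k X : (k <= n)%N -> X \in L k -> X \in F k.
Proof.
elim: k X => [|k IH] X; first by move=> _ _; apply: (flag_top flagF).
move=> ltkn; apply: (lcs_ind (subspace_mem _)) => Y Z /(IH _ (ltnW ltkn)).
exact: (flag_br flagF _).
Qed.

Hypothesis L3 : lcs g 3 = [set 0]%classic.

Lemma br_lcs2 X Y : X \in L 2 -> br X Y = 0.
Proof. by move/(br_lcs Y)/mem_lcs; rewrite L3. Qed.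

Definition covers (U : {vspace g}) (j : nat) : Prop :=
  (F j <= U + F j.+1)%VS.

Lemma coversP U j : covers U j <->
  forall X, X \in F j -> exists2 Z, Z \in U & X - Z \in F j.+1.
Proof.
split=> [/subvP cU X /cU /memv_addP[Z ZU [W Wj ->]] | cU].
  by exists Z => //; rewrite addrC addKr.
apply/subvP => X /cU [Z ZU XZ]; rewrite -(subrKC Z X).
by apply: memv_add.
Qed.

Lemma flag_drop j : (j.+1 < n)%N ->
  ~ (forall X, X \in F j -> forall Y, br X Y \in F j.+2).
Proof.
move=> ltjn dead; have [X Xj] := flag_strict flagF (ltnW ltjn).
case/negP; apply: (flag_lift flagF ltjn) => Y; split; apply: dead => //.
exact: (flag_J flagF).
Qed.

Lemma lcs1_meets_line j : (j.+1 < n)%N ->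
  exists2 Z, Z \in L 1 /\ Z \in F j.+1 & Z \notin F j.+2.
Proof.
move=> ltjn; apply: contrapT => no; apply: (@flag_drop j ltjn) => X Xj Y.
apply/negPn/negP => nXY; apply: no; exists (br X Y) => //; split.
  exact/br_lcs/mem_lcs0.
exact: (flag_br flagF _ (ltnW ltjn)).
Qed.

(** A central element is invisible to brackets with F j, so a covering L 2
    would make all of F j drop two steps. *)
Lemma lcs2_not_covers j : (j.+1 < n)%N -> ~ covers (L 2) j.
Proof.
move=> ltjn /coversP cov; apply: (@flag_drop j ltjn) => X Xj Y.
have [Z ZL XZ] := cov X Xj.
rewrite -(subrK Z X) brDl (br_lcs2 _ ZL) addr0.
exact: (flag_br flagF _ ltjn).
Qed.

(** In the first line where Z' is nonzero, Z = -JZ' would be independent of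
    Z', and together they would cover that line, which L 2 cannot do. *)
Lemma lcs2_J_independent m Z Z' : (m < n)%N -> Z \in L 2 -> Z' \in L 2 ->
  Z + J Z' \in F m -> Z \in F m /\ Z' \in F m.
Proof.
move=> ltmn ZL ZL'; elim: m ltmn => [|m IH] ltmn ZZ'.
  by split; apply: (flag_top flagF).
have [Zm Zm'] := IH (ltnW ltmn) (flag_desc flagF ZZ').
suff Zm1' : Z' \in F m.+1.
  by split=> //; rewrite -(addrK (J Z') Z) memvB // (flag_J flagF).
apply/negPn/negP => nZ'; apply: (lcs2_not_covers ltmn); apply/coversP => X Xm.
have [p [q pq]] := flag_line flagF (ltnW ltmn) Zm' nZ' Xm.
exists (p *: Z' - q *: Z); first by rewrite memvB ?memvZ.
have := memvD pq (memvZ q ZZ'); rewrite scalerDr opprD opprB !addrA.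
by rewrite [_ - _ + q *: Z]addrAC subrK addrAC.
Qed.

(** With Z central, [JZ,g] fills the next line. *)
Lemma lcs1_covers_next j Z : (j.+1 < n)%N -> Z \in L 2 -> Z \in F j ->
  Z \notin F j.+1 -> covers (L 1) j.+1.
Proof.
move=> ltjn ZL Zj Zj1; apply/coversP => X Xj.
have [Y XY] : exists Y, X - br (J Z) Y \in F j.+2.
  by apply: adJ_onto => // Y; rewrite br_lcs2 ?mem0v.
by exists (br (J Z) Y) => //; apply/br_lcs/mem_lcs0.
Qed.

(** If L 1 covers the line of Z, then JZ may be replaced by an element X of
    L 1, and [X,g], inside L 2, would cover the next line. *)
Lemma lcs2_misses_covered j Z : (j.+2 < n)%N -> covers (L 1) j ->
  Z \in L 2 -> Z \in F j -> Z \in F j.+1.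
Proof.
move=> ltjn /coversP cov ZL Zj; apply/negPn/negP => Zj1.
have [X XL ZX] := cov (J Z) (flag_J flagF Zj).
apply: (lcs2_not_covers ltjn); apply/coversP => W Wj.
have [Y WY] : exists Y, W - br (J Z) Y \in F j.+2.
  by apply: (adJ_onto (ltnW ltjn)) => // Y; rewrite br_lcs2 ?mem0v.
exists (br X Y); first exact: br_lcs.
have : br (J Z - X) Y \in F j.+2 by apply: (flag_br flagF _ (ltnW ltjn)).
by rewrite brDl brNl => /(memvD WY); rewrite addrA subrK.
Qed.

(** For Z in L 1 on the previous line, [Z,g] lies in L 2 and so vanishes in
    the missed line, which [JZ,g] then fills. *)
Lemma lcs1_covers_missed j : (j.+2 < n)%N ->
  (forall Z, Z \in L 2 -> Z \in F j.+2 -> Z \in F j.+3) ->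
  covers (L 1) j.+2.
Proof.
move=> ltjn miss; have [Z [ZL Zj] Zj1] := lcs1_meets_line (ltnW ltjn).
apply/coversP => X Xj.
have [Y XY] : exists Y, X - br (J Z) Y \in F j.+3.
  apply: adJ_onto => // Y; apply: miss; first exact: br_lcs.
  exact: (flag_br flagF _ (ltnW ltjn)).
by exists (br (J Z) Y) => //; apply/br_lcs/mem_lcs0.
Qed.

(** Otherwise every bracket with F j would, modulo F (j+2), come from
    [L 1,g] = L 2, which has no trace on the next line. *)
Lemma lcs1_not_covers_before_missed j : (j.+1 < n)%N ->
  (forall Z, Z \in L 2 -> Z \in F j.+1 -> Z \in F j.+2) ->
  ~ covers (L 1) j.
Proof.
move=> ltjn miss /coversP cov; apply: (@flag_drop j ltjn) => X Xj Y.
have [Z ZL XZ] := cov X Xj.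
have Zj : Z \in F j by rewrite -(subKr X Z) memvB //; apply: (flag_desc flagF).
rewrite -(subrK Z X) brDl memvD //; first exact: (flag_br flagF _ ltjn).
by apply: miss; [apply: br_lcs | apply: (flag_br flagF _ (ltnW ltjn))].
Qed.

Lemma uncovered_meets_lcs2 j : (j.+2 < n)%N -> ~ covers (L 1) j.+2 ->
  exists2 Z, Z \in L 2 /\ Z \in F j.+2 & Z \notin F j.+3.
Proof.
move=> ltjn ncov; apply: contrapT => no; apply: ncov.
apply: lcs1_covers_missed => // Z ZL Zj; apply/negPn/negP => nZ.
by apply: no; exists Z.
Qed.

Lemma covers_alternate j : (j + 5 < n)%N ->
  covers (L 1) j.+3 <-> ~ covers (L 1) j.+2.
Proof.
move=> ltjn; split=> [cov | ncov].
  apply: lcs1_not_covers_before_missed => [|Z ZL Zj]; first by lia.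
  by apply: lcs2_misses_covered => //; lia.
have [|Z [ZL Zj] nZ] := uncovered_meets_lcs2 _ ncov; first by lia.
by apply: lcs1_covers_next nZ => //; lia.
Qed.
End Flag.

(** * The flag of a maximal nilpotent complex structure *)

Section MaxNFlag.
Import passmx.

Variables (R : realType) (g : lieAlgType R) (J : 'End(g)).
Hypothesis cJ : complex_structure J.
Implicit Types X Y Z : g.
Local Notation a k := (vspace_of (ak J k)).

(** det J is real and its square is (-1)^dim. *)
Lemma dim_even : ~~ odd (\dim {: g}).
Proof.
pose e := vbasis {: g}; have be : basis_of {: g} e := vbasisP _.
pose M := mxof e e J.
have MM : M *m M = - 1%:M.
  rewrite -mxof_comp // -(mxof1 (basis_free be)) -linearN.
  congr (mxof e e _); apply/lfunP => X.
  by rewrite comp_lfunE opp_lfunE id_lfunE (complex_structureK cJ).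
have := congr1 determinant MM; rewrite det_mulmx -scaleN1r detZ det1 mulr1.
rewrite -expr2 => dM.
apply/negP => od; have := sqr_ge0 (\det M).
by rewrite dM -signr_odd od expr1 oppr_ge0 ler10.
Qed.

Lemma subspace_ak k : subspace (ak J k).
Proof.
elim: k => [|k [IH0 IH]]; first by split=> // c x y -> ->; rewrite scaler0 addr0.
split=> [Y|c x y xk yk Y]; first by rewrite linear0 br0l.
have [x1 x2] := xk Y; have [y1 y2] := yk Y.
by rewrite linearD linearZ /= !brDl !brZl; split; apply: IH.
Qed.

Lemma mem_ak k X : X \in a k <-> ak J k X.
Proof. exact/mem_vspace_of/subspace_ak. Qed.

Lemma ak_0 X : X \in a 0 -> X = 0. Proof. by move/mem_ak. Qed.

Lemma akS k X : X \in a k.+1 <-> forall Y, br X Y \in a k /\ br (J X) Y \in a k.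
Proof.
split=> [/mem_ak Xk Y | Xk]; first by have [] := Xk Y; split; apply/mem_ak.
by apply/mem_ak => Y; have [] := Xk Y; split; apply/mem_ak.
Qed.

Lemma ak_desc k X : X \in a k -> X \in a k.+1.
Proof.
elim: k X => [|k IH] X.
  by move/ak_0 => ->; apply: mem0v.
by move/akS=> Xk; apply/akS => Y; have [] := Xk Y; split; apply: IH.
Qed.

Lemma ak_le j k X : (j <= k)%N -> X \in a j -> X \in a k.
Proof.
by move=> /subnK <-; elim: (k - j)%N => [//|d IH] /IH; apply: ak_desc.
Qed.

Lemma ak_J k X : X \in a k -> J X \in a k.
Proof.
case: k => [/ak_0 ->|k /akS Xk]; first by rewrite linear0 mem0v.
apply/akS => Y; have [XY JXY] := Xk Y.
by rewrite (complex_structureK cJ) brNl memvN.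
Qed.

Lemma dim_add_line (U : {vspace g}) X :
  X \notin U -> \dim (U + <[X]>) = (\dim U).+1.
Proof.
move=> XU; have X0 : X != 0 by apply: contraNneq XU => ->; apply: mem0v.
rewrite dimv_disjoint_sum ?dim_vline ?X0 ?addn1 //.
apply/eqP; rewrite -subv0; apply/subvP => Y; rewrite memv_cap memv0.
case/andP=> YU /vlineP[c eY]; rewrite eY in YU *.
have [->|c0] := eqVneq c 0; first by rewrite scale0r.
by case/negP: XU; have := memvZ c^-1 YU; rewrite scalerA mulVf // scale1r.
Qed.

Lemma dim_add_complex_line (U : {vspace g}) X :
  (forall Y, Y \in U -> J Y \in U) -> X \notin U ->
  \dim (U + <[X]> + <[J X]>) = (\dim U).+2.
Proof.
move=> JU XU; rewrite dim_add_line ?dim_add_line //.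
apply/negP => /memv_addP[u uU [_ /vlineP[c ->] JX]].
have : (- c) *: X + 1 *: J X \in U by rewrite JX scale1r scaleNr addrC addrK.
by case/(J_indep_mod cJ JU XU) => _ /eqP; rewrite oner_eq0.
Qed.

Hypothesis stepJ : is_step_J J (dimC g).
Local Notation n := (dimC g).

Lemma ak_top X : X \in a n.
Proof. by apply/mem_ak; case: stepJ => ->. Qed.

(** A repetition would make the series stationary before reaching g. *)
Lemma ak_strict k : (k < n)%N -> exists2 X, X \in a k.+1 & X \notin a k.
Proof.
move=> ltkn; apply: contrapT => no.
have sub X : X \in a k.+1 -> X \in a k.
  by move=> X1; apply/negPn/negP => nX; apply: no; exists X.
have stable d X : X \in a (d + k) -> X \in a k.
  elim: d X => [//|d IH] X; rewrite addSn => /akS Xd; apply: sub; apply/akS => Y.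
  by have [] := Xd Y; split; apply: IH.
case: stepJ => _ /(_ k) least; move: ltkn; rewrite ltnNge => /negP; apply.
apply: least; apply/seteqP; split=> // X _; apply/mem_ak.
by apply: (stable n); apply: ak_le (ak_top X); apply: leq_addr.
Qed.

(** Each step of the series grows by at least a complex line; since there are
    as many steps as complex dimensions, it grows by exactly one. *)
Lemma dim_ak k : (k <= n)%N -> \dim (a k) = k.*2.
Proof.
have grow j : (j < n)%N -> ((\dim (a j)).+2 <= \dim (a j.+1))%N.
  move=> /ak_strict[X Xj1 Xj]; rewrite -(dim_add_complex_line (@ak_J j) Xj).
  apply: dimvS; rewrite !subv_add -!memvE ak_J // Xj1 !andbT.
  by apply/subvP => Y; apply: ak_desc.
have low j : (j <= n)%N -> (j.*2 <= \dim (a j))%N.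
  elim: j => [//|j IH] ltjn; apply: leq_trans (grow j ltjn).
  by rewrite doubleS !ltnS; apply: IH; apply: ltnW.
have up d : (d <= n)%N -> (\dim (a (n - d)) + d.*2 <= n.*2)%N.
  elim: d => [|d IH] ltdn.
    rewrite addn0 subn0; apply: leq_trans (dimvS (subvf _)) _.
    by rewrite /dimC even_halfK // dim_even.
  apply: leq_trans (IH (ltnW ltdn)); rewrite doubleS !addnS -!addSn leq_add2r.
  by rewrite -(@subnSK d n) //; apply: grow; lia.
move=> lekn; apply/eqP; rewrite eqn_leq low // andbT.
by have := up (n - k)%N (leq_subr _ _); rewrite subKn //; lia.
Qed.

Lemma complex_flag_ak : complex_flag J n (fun k => a (n - k)).
Proof.
split=> [X|X|k X|k X|k X Y ltkn|k X ltkn|k ltkn|k X Y ltkn Xk Xk1 Yk].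
- by rewrite subn0; apply: ak_top.
- by rewrite subnn; apply: ak_0.
- have [ltkn|lenk] := ltnP k n; first by rewrite -(subnSK ltkn); apply: ak_desc.
  by rewrite (_ : n - k.+1 = n - k)%N //; lia.
- exact: ak_J.
- by rewrite -(subnSK ltkn) => /akS Xk; case: (Xk Y).
- by rewrite -(subnSK ltkn) => Xk; apply/akS.
- by rewrite -(subnSK ltkn); apply: ak_strict; lia.
- pose U := (a (n - k.+1) + <[X]> + <[J X]>)%VS.
  have /eqP UE : U == a (n - k).
    rewrite eqEdim (dim_add_complex_line (@ak_J _) Xk1) !dim_ak ?leq_subr //.
    rewrite -doubleS subnSK // leqnn andbT !subv_add -!memvE ak_J // Xk !andbT.
    by rewrite -(subnSK ltkn); apply/subvP => Z; apply: ak_desc.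
  move: Yk; rewrite -UE => /memv_addP[_ /memv_addP[u uU [_ /vlineP[p ->] ->]]].
  case=> _ /vlineP[q ->] ->; exists p, q.
  by rewrite opprD addrA addrAC addrK addrK.
Qed.
End MaxNFlag.

(** * The ascending series V^k as annihilators *)

Section Annihilators.
Variables (R : realType) (g : lieAlgType R).
Implicit Types X Y Z : g.
Local Notation L k := (vspace_of (lcs g k)).

(** The converse inclusion is the point: a two-form which vanishes when one
    argument is in L k is a combination of wedges of functionals
    vanishing on L k: expand both arguments in coordinates modulo L k and
    antisymmetrize. *)
Lemma VkP k (be : 'Hom(g, R^o)) : Vk g k be <-> forall X, X \in L k -> be X = 0.
Proof.
elim: k be => [|k IH] be.
  split=> [-> X _|be0]; first by rewrite zero_lfunE.
  by apply/lfunP => X; rewrite zero_lfunE be0 // mem_lcs0.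
split=> [Hbe X | be0].
  have sP : subspace [set eta : g -> g -> R^o |
      forall Z, Z \in L k -> forall Y, eta Z Y = 0]%classic.
    split=> [Z _ Y //|a x y x0 y0 Z ZL Y].
    by rewrite !fctE x0 // y0 // scaler0 addr0.
  have := span_sub sP _ Hbe; move=> /(_ _)/[dup] kill {}Hbe.
  have {}kill : forall Z, Z \in L k -> forall Y, dCE be Z Y = 0.
    apply: kill => _ [b [c [/IH b0 /IH c0 ->]]] Z ZL Y.
    by rewrite /wedge b0 // (c0 _ ZL) mulr0 mul0r subrr.
  apply: (lcs_ind (subspace_kernel be)).
  by move=> Z Y ZL /=; have /eqP := kill Z ZL Y; rewrite oppr_eq0 => /eqP.
have [m [e [x [x0 xe]]]] := coordinates_mod (L k).
rewrite /=; set A := (X in span_set X).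
suff -> : dCE be = \sum_i 1 *: \sum_j (- be (br (e i) (e j)) / 2)
    *: wedge (x i) (x j) :> (g -> g -> R^o).
  apply: subspace_sum; first exact: subspace_span.
  move=> i; apply: subspace_sum; first exact: subspace_span.
  by move=> j; apply: mem_span; exists (x i), (x j); split=> //; apply/IH; apply: x0.
have dbe X Y : be (br X Y) = \sum_i \sum_j x i X * x j Y * be (br (e i) (e j)).
  have killl Z W : Z \in L k -> be (br Z W) = 0 by move=> ZL; apply/be0/br_lcs.
  have killr Z W : Z \in L k -> be (br W Z) = 0.
    by move=> ZL; rewrite brC linearN /= killl ?oppr0.
  rewrite -[X in br X _](subrK (\sum_i x i X *: e i)) brDl linearD /= killl // add0r.
  rewrite -[Y in br _ Y](subrK (\sum_i x i Y *: e i)) brDr linearD /= killr // add0r.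
  rewrite br_suml linear_sum /=; apply: eq_bigr => i _.
  rewrite br_sumr linear_sum /=; apply: eq_bigr => j _.
  by rewrite brZl brZr !linearZ /= /GRing.scale /= mulrA.
apply/funext => X; apply/funext => Y; rewrite /dCE.
have -> : - be (br X Y) = - (be (br X Y) - be (br Y X)) / 2.
  by rewrite [br Y X]brC linearN opprK; field.
rewrite !dbe -sumrB !fct_sumE -sumrN mulr_suml; apply: eq_bigr => i _.
rewrite scale1r !fct_sumE -sumrB -sumrN mulr_suml; apply: eq_bigr => j _.
by rewrite !fctE /wedge /GRing.scale /=; ring.
Qed.
End Annihilators.

(** * Forms of type (1,0) *)

Section ComplexForms.
Local Open Scope complex_scope.
Variables (R : realType) (g : lieAlgType R).
Implicit Types (X Y Z : g) (w u : g -> R[i]) (z : R[i]).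

Definition rlinear w : Prop := linear (w : g -> Rcomplex R).

Lemma scale_RcomplexE (a : R) z : a *: (z : Rcomplex R) = a%:C * z.
Proof.
by case: z => x y; apply/eqP; rewrite eq_complex /= !mul0r subr0 addr0 !eqxx.
Qed.

Lemma scalefE z w X : (z *: w) X = z * w X. Proof. by []. Qed.

Section RealLinear.
Variables (w : g -> R[i]) (lw : rlinear w).

Lemma rlinP a X Y : w (a *: X + Y) = a%:C * w X + w Y.
Proof. by rewrite lw scale_RcomplexE. Qed.

Lemma rlinD X Y : w (X + Y) = w X + w Y.
Proof. by rewrite -{1}[X]scale1r rlinP mul1r. Qed.

Lemma rlin0 : w 0 = 0.
Proof. by apply: (addrI (w 0)); rewrite -rlinD !addr0. Qed.

Lemma rlinZ a X : w (a *: X) = a%:C * w X.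
Proof. by rewrite -[a *: X]addr0 rlinP rlin0 addr0. Qed.

Lemma rlinN X : w (- X) = - w X.
Proof. by rewrite -scaleN1r rlinZ rmorphN mulN1r. Qed.

Lemma rlinB X Y : w (X - Y) = w X - w Y.
Proof. by rewrite rlinD rlinN. Qed.

Lemma rlin_sum (I : Type) (r : seq I) (F : I -> g) :
  w (\sum_(i <- r) F i) = \sum_(i <- r) w (F i).
Proof. by apply: (big_morph w) => [X Y|]; rewrite ?rlinD ?rlin0. Qed.
End RealLinear.

Lemma rlinI w : (forall a X Y, w (a *: X + Y) = a%:C * w X + w Y) -> rlinear w.
Proof. by move=> lw a X Y; rewrite lw scale_RcomplexE. Qed.

Lemma subspace_rker w : rlinear w -> subspace [set X | w X = 0]%classic.
Proof.
move=> lw; split=> [|a x y] /=; first exact: rlin0.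
by rewrite rlinP // => -> ->; rewrite mulr0 addr0.
Qed.

Lemma rlin_fbar w : rlinear w -> rlinear (fbar w).
Proof.
move=> lw; apply: rlinI => a X Y; rewrite /fbar rlinP // rmorphD rmorphM /=.
by rewrite oppr0.
Qed.

Lemma rlin_scale z w : rlinear w -> rlinear (z *: w).
Proof.
move=> lw; apply: rlinI => a X Y.
by rewrite !scalefE rlinP // mulrDr mulrCA.
Qed.

Lemma rlin_add w u : rlinear w -> rlinear u -> rlinear (w + u).
Proof.
move=> lw lu; apply: rlinI => a X Y.
by rewrite !fctE !rlinP // mulrDr addrACA.
Qed.

Lemma rlin_zero : rlinear (0 : g -> R[i]).
Proof. by apply: rlinI => a X Y; rewrite mulr0 addr0. Qed.

Local Notation L k := (vspace_of (lcs g k)).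

Lemma VkCP k w : VkC g k w <-> rlinear w /\ forall X, X \in L k -> w X = 0.
Proof.
split=> [[be [ga [/VkP b0 /VkP c0 wE]]] | [lw w0]].
  split=> [|X XL]; last by rewrite wE b0 // c0.
  apply: rlinI => a X Y; rewrite !wE !linearP /=.
  by apply/eqP; rewrite eq_complex /= !mul0r subr0 addr0 !eqxx.
have lRe : linear (fun X => complex.Re (w X) : R^o).
  move=> a X Y; rewrite rlinP // raddfD /=.
  by case: (w X) => p q /=; rewrite mul0r subr0.
have lIm : linear (fun X => complex.Im (w X) : R^o).
  move=> a X Y; rewrite rlinP // raddfD /=.
  by case: (w X) => p q /=; rewrite mul0r addr0.
pose be : {linear g -> R^o} := HB.pack (fun X => complex.Re (w X) : R^o)
  (GRing.isLinear.Build _ _ _ _ _ lRe).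
pose ga : {linear g -> R^o} := HB.pack (fun X => complex.Im (w X) : R^o)
  (GRing.isLinear.Build _ _ _ _ _ lIm).
exists (linfun be), (linfun ga); split=> [||X].
- by apply/VkP => X XL; rewrite lfunE /= w0.
- by apply/VkP => X XL; rewrite lfunE /= w0.
- by rewrite !lfunE /=; case: (w X).
Qed.

Section TypeOneZero.
Variable J : 'End(g).
Hypothesis cJ : complex_structure J.

(** Multiplication by z in the complex vector space (g, J). *)
Definition cscale z X : g := complex.Re z *: X + complex.Im z *: J X.

Definition lin_part w X := (w X - 'i%C * w (J X)) / 2.
Definition antilin_part w X := (w X + 'i%C * w (J X)) / 2.

Lemma sqr_iE : 'i%C * 'i%C = -1 :> R[i].
Proof.
apply/eqP; rewrite eq_complex /=.
by rewrite !(mul0r, mulr0, mulr1, addr0, sub0r, oppr0) !eqxx.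
Qed.

Lemma rlin_cscale w z X : rlinear w ->
  w (cscale z X) = z * lin_part w X + conjc z * antilin_part w X.
Proof.
move=> lw; rewrite /cscale rlinD // !rlinZ // /lin_part /antilin_part.
have -> : conjc z = (complex.Re z)%:C - 'i%C * (complex.Im z)%:C.
  by rewrite [z]complexE; simpc.
move: (complex.Re z)%:C (complex.Im z)%:C (complexE z) => a b ->.
move: (w X) (w (J X)) => p q.
transitivity (a * p - ('i%C * 'i%C) * b * q); last by field.
by rewrite sqr_iE; ring.
Qed.

Lemma g10_rlin w : g10 J w -> rlinear w. Proof. by case. Qed.

Lemma g10_J w X : g10 J w -> w (J X) = 'i%C * w X. Proof. by case. Qed.

Lemma g10_lin_part w X : g10 J w -> lin_part w X = w X.
Proof.
move=> hw; rewrite /lin_part g10_J // mulrA sqr_iE.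
by field.
Qed.

Lemma g10_antilin_part w X : g10 J w -> antilin_part w X = 0.
Proof.
by move=> hw; rewrite /antilin_part g10_J // mulrA sqr_iE mulN1r subrr mul0r.
Qed.

Lemma g10_cscale w z X : g10 J w -> w (cscale z X) = z * w X.
Proof.
move=> hw; rewrite rlin_cscale ?g10_lin_part ?g10_antilin_part //.
  by rewrite mulr0 addr0.
exact: g10_rlin.
Qed.

Lemma mem_cscale (U : {vspace g}) z X :
  (forall Y, Y \in U -> J Y \in U) -> X \in U -> cscale z X \in U.
Proof. by move=> JU XU; rewrite memvD ?memvZ ?JU. Qed.

Lemma g10_scale z w : g10 J w -> g10 J (z *: w).
Proof.
move=> hw; split=> [|X]; first exact/rlin_scale/g10_rlin.
by rewrite !scalefE g10_J // mulrCA.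
Qed.

Lemma g10_real_part (f : 'Hom(g, R^o)) :
  exists w, [/\ g10 J w, forall X, complex.Re (w X) = f X
    & forall X, w X = f X +i* (- f (J X))].
Proof.
exists (fun X => (f X : R) +i* (- f (J X) : R)); split=> //; split.
  have fP a X Y : f (a *: X + Y) = a * f X + f Y by rewrite linearD linearZ.
  have JP a X Y : J (a *: X + Y) = a *: J X + J Y by rewrite linearD linearZ.
  apply: rlinI => a X Y; rewrite JP !fP.
  by apply/eqP; rewrite eq_complex /=; apply/andP; split; apply/eqP; ring.
by move=> X; rewrite (complex_structureK cJ) linearN /= opprK; simpc.
Qed.

Section Leading.
Variables (n : nat) (F : nat -> {vspace g}).
Hypothesis flagF : complex_flag J n F.

Definition leads j w : Prop :=
  [/\ g10 J w, forall X, X \in F j.+1 -> w X = 0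
    & forall X, X \in F j -> w X = 0 -> X \in F j.+1].

(** Take w with real part a functional separating X from U. The kernel of w on
    F j is J-stable, so it cannot be strictly between F (j+1) and F j. *)
Lemma lead_exists (U : {vspace g}) j X : (j < n)%N -> X \in F j -> X \notin U ->
  (forall Y, Y \in F j.+1 -> Y \in U) ->
  exists w, leads j w /\ forall Y, Y \in U -> complex.Re (w Y) = 0.
Proof.
move=> ltjn Xj XU FU; have [f [f0 fX]] := separating_functional XU.
have [w [hw wRe wE]] := g10_real_part f.
have w0 Y : Y \in F j.+1 -> w Y = 0.
  by move=> Yj; rewrite wE !f0 ?oppr0 //; apply: FU => //; apply: (flag_J flagF).
exists w; split; last by move=> Y YU; rewrite wRe f0.
split=> // Y Yj wY; apply/negPn/negP => nY; case/eqP: fX; rewrite -wRe.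
have [p [q pq]] := flag_line flagF ltjn Yj nY Xj.
rewrite -[X](subrK (p *: Y + q *: J Y)) (rlinD (g10_rlin hw) (X - _)) w0 // add0r.
by rewrite (rlinD (g10_rlin hw)) !(rlinZ (g10_rlin hw)) g10_J // wY !mulr0 addr0.
Qed.

Lemma lead_value j w z : (j < n)%N -> leads j w ->
  exists2 X, X \in F j & w X = z.
Proof.
move=> ltjn [hw _ w1]; have [X Xj Xj1] := flag_strict flagF ltjn.
exists (cscale (z / w X) X).
  by apply: mem_cscale => // Y; apply: (flag_J flagF).
rewrite g10_cscale // mulfVK //; apply: contraNneq Xj1; exact: w1.
Qed.

(** The first k members cut out F k; the shift is that of coframes, which are
    indexed from 1 whereas lines are indexed from 0. *)
Definition adapted (om : nat -> g -> R[i]) : Prop :=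
  forall j, (j < n)%N -> leads j (om j.+1).

Section Coframe.
Variable om : nat -> g -> R[i].
Hypothesis lead_om : adapted om.

Lemma adapted_g10 k : (1 <= k <= n)%N -> g10 J (om k).
Proof. by case: k => // k /lead_om[]. Qed.

Lemma adapted_kill j k X : (1 <= k <= n)%N -> (k <= j)%N -> X \in F j -> om k X = 0.
Proof.
case: k => // k /lead_om[_ w0 _] lekj Xj; apply: w0.
exact: (flag_le flagF lekj).
Qed.

Lemma adapted_mem m X : (m <= n)%N -> (forall k, (1 <= k <= m)%N -> om k X = 0) ->
  X \in F m.
Proof.
elim: m => [|m IH] ltmn X0; first exact: (flag_top flagF).
have [_ _ w1] := lead_om ltmn; apply: w1; last by apply: X0; rewrite ltnS leqnn.
apply: IH => [|k /andP[k1 km]]; first exact: ltnW.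
by apply: X0; rewrite k1 leqW.
Qed.

(** Start from a vector of F j normalized by omega^(j+1) and remove, one after
    the other, its components along the later lines. *)
Lemma dual_frame : exists E : nat -> g, forall i, (1 <= i <= n)%N ->
  E i \in F i.-1 /\ forall k, (1 <= k <= n)%N -> om k (E i) = (i == k)%:R.
Proof.
suff ex j : (j < n)%N -> exists e, e \in F j /\
    forall k, (1 <= k <= n)%N -> om k e = (j.+1 == k)%:R.
  have /choice[E HE] : forall i, exists e, (1 <= i <= n)%N -> e \in F i.-1 /\
      forall k, (1 <= k <= n)%N -> om k e = (i == k)%:R.
    move=> [|i]; first by exists 0.
    have [/ex[e He]|nlt] := ltnP i n; first by exists e.
    by exists 0 => ?; exfalso; lia.
  by exists E.
move=> ltjn.
suff [e [ej He]] : exists e, e \in F j /\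
    forall k, (j < k <= n)%N -> om k e = (j.+1 == k)%:R.
  exists e; split=> // k /[dup] kn /andP[k1 _]; have [lekj|ltjk] := leqP k j.
    by rewrite (adapted_kill kn lekj ej) gtn_eqF.
  by apply: He; rewrite ltjk; case/andP: kn.
suff ex d : (j.+1 + d <= n)%N -> exists e, e \in F j /\
    forall k, (j < k <= j.+1 + d)%N -> om k e = (j.+1 == k)%:R.
  by have := ex (n - j.+1)%N; rewrite subnKC //; apply.
elim: d => [|d IH] ledn.
  have [e ej e1] := lead_value 1 ltjn (lead_om ltjn); exists e; split=> // k.
  by rewrite addn0 => /anti_leq <-; rewrite e1 eqxx.
have [|e [ej He]] := IH; first by lia.
have ltn : (j.+1 + d < n)%N by lia.
have [x xd x1] := lead_value 1 ltn (lead_om ltn).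
have xj : x \in F j by apply: (flag_le flagF _ xd); lia.
exists (e - cscale (om (j.+1 + d).+1 e) x); split.
  by rewrite memvB // mem_cscale //; apply: (flag_J flagF).
move=> k /andP[ltjk lek].
have kn : (1 <= k <= n)%N by lia.
rewrite (rlinB (g10_rlin (adapted_g10 kn))) (g10_cscale _ _ (adapted_g10 kn)).
move: lek; rewrite addnS leq_eqVlt => /orP[/eqP ->|lek].
  by rewrite x1 mulr1 subrr ltn_eqF //; lia.
rewrite (adapted_kill kn _ xd) ?mulr0 ?subr0; last by lia.
by apply: He; rewrite ltjk; lia.
Qed.

End Coframe.
End Leading.
End TypeOneZero.
End ComplexForms.

(** * Structure equations *)

Lemma sum_square_triangle (V : zmodType) (k : nat) (f : nat -> nat -> V) :
  (forall i, f i i = 0) ->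
  \sum_(1 <= i < k.+1) \sum_(1 <= j < k.+1) f i j =
  \sum_(1 <= j < k.+1) \sum_(1 <= i < j) (f i j + f j i).
Proof.
move=> f0; elim: k => [|k IH]; first by rewrite !big_geq.
rewrite [LHS](big_nat_recr k.+1) //= [RHS](big_nat_recr k.+1) //= -IH.
rewrite [\sum_(1 <= j < k.+2) f k.+1 j](big_nat_recr k.+1) //= f0 addr0.
rewrite [X in _ = _ + X]big_split /= addrA; congr (_ + _).
rewrite -big_split /=.
by apply: eq_bigr => i _; rewrite (big_nat_recr k.+1).
Qed.

Lemma form_sum2E (R : realType) (T : Type) (I K : Type) (r : seq I)
    (s : I -> seq K) (c : I -> K -> R[i]) (W : I -> K -> T -> T -> R[i]) X Y :
  (\sum_(i <- r) \sum_(j <- s i) c i j *: W i j) X Y =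
  \sum_(i <- r) \sum_(j <- s i) c i j * W i j X Y.
Proof.
rewrite (big_morph (fun f : T -> T -> R[i] => f X Y) (id1 := 0) (op1 := +%R)) //.
apply: eq_bigr => i _.
by rewrite (big_morph (fun f : T -> T -> R[i] => f X Y) (id1 := 0) (op1 := +%R)).
Qed.

Section StructureEquations.
Variables (R : realType) (g : lieAlgType R) (J : 'End(g)) (n : nat).
Variables (F : nat -> {vspace g}).
Hypothesis cJ : complex_structure J.
Hypothesis flagF : complex_flag J n F.
Implicit Types (X Y Z : g) (w u : g -> R[i]) (z : R[i]).

Lemma rlin_brl w Y : rlinear w -> rlinear (fun X => w (br X Y)).
Proof. by move=> lw; apply: rlinI => a X Z; rewrite brDl brZl rlinP. Qed.

(** Integrability in the form: d w has no component of type (0,2). *)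
Lemma g10_antilin_br w X : g10 J w ->
  g10 J (fun Y => antilin_part J (fun Z => w (br Z Y)) X).
Proof.
move=> hw; have lw := g10_rlin hw; split.
  apply: rlinI => a Y Z; rewrite /antilin_part !brDr !brZr !rlinP //.
  by field.
move=> Y; rewrite /antilin_part.
have -> : w (br (J X) (J Y)) =
    'i%C * w (br (J X) Y) + 'i%C * w (br X (J Y)) + w (br X Y).
  by case: cJ => _ ->; rewrite !rlinD // !g10_J.
have := sqr_iE R; move: 'i%C => i ii.
set a := w (br (J X) Y); set b := w (br X (J Y)); set c := w (br X Y).
transitivity ((b + (i * i) * (a + b) + i * c) / 2); first by field.
transitivity ((i * c + (i * i) * a) / 2); last by field.
by rewrite ii; field.
Qed.

Section Coframe.
Variable om : nat -> g -> R[i].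
Hypothesis lead_om : adapted J n F om.

Section DualFrame.
Variable E : nat -> g.
Hypothesis dualE : forall i, (1 <= i <= n)%N ->
  E i \in F i.-1 /\ forall k, (1 <= k <= n)%N -> om k (E i) = (i == k)%:R.

Lemma sum_delta m k (f : nat -> R[i]) : (1 <= k < m)%N ->
  \sum_(1 <= i < m) f i * (i == k)%:R = f k.
Proof.
move=> km; rewrite (eq_bigr (fun i => if i == k then f i else 0)).
  by rewrite -big_mkcond /= big_nat1_eq km.
by move=> i _; case: eqP; rewrite ?mulr1 ?mulr0.
Qed.

Lemma frame_expand m X : (m <= n)%N ->
  X - \sum_(1 <= i < m.+1) cscale J (om i X) (E i) \in F m.
Proof.
move=> lemn; apply: (adapted_mem flagF lead_om) => // k /andP[k1 km].
have kn : (1 <= k <= n)%N by lia.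
have hk := adapted_g10 lead_om kn.
rewrite (rlinB (g10_rlin hk)) (rlin_sum (g10_rlin hk)).
rewrite (eq_big_nat _ _ (F2 := fun i => om i X * (i == k)%:R)).
  by rewrite sum_delta ?subrr //; lia.
move=> i im; rewrite g10_cscale //; congr (_ * _).
have ii : (1 <= i <= n)%N by lia.
by have [_ ->] := dualE ii.
Qed.

Lemma rlin_expand m w X : (m <= n)%N -> rlinear w ->
  (forall Y, Y \in F m -> w Y = 0) ->
  w X = \sum_(1 <= i < m.+1)
    (om i X * lin_part J w (E i) + conjc (om i X) * antilin_part J w (E i)).
Proof.
move=> lemn lw w0.
have /w0 := frame_expand X lemn.
rewrite rlinB // => /eqP; rewrite subr_eq0 => /eqP ->.
by rewrite rlin_sum //; apply: eq_bigr => i _; rewrite rlin_cscale.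
Qed.

Lemma g10_expand m w X : (m <= n)%N -> g10 J w ->
  (forall Y, Y \in F m -> w Y = 0) ->
  w X = \sum_(1 <= i < m.+1) om i X * w (E i).
Proof.
move=> lemn hw w0; rewrite (rlin_expand X lemn (g10_rlin hw) w0).
apply: eq_bigr => i _.
by rewrite g10_lin_part // g10_antilin_part // mulr0 addr0.
Qed.
End DualFrame.

Definition structure_eq (A B : nat -> nat -> R[i]) (k : nat) : Prop :=
  dCE (om k) =
    \sum_(1 <= j < k) \sum_(1 <= i < j) A i j *: wedge (om i) (om j)
    + \sum_(1 <= i < k) \sum_(1 <= j < k) B i j *: wedge (om i) (fbar (om j)).

(** Expand omega^k([X,Y]) first in X, then in Y, along a dual frame of the
    first k - 1 members: brackets with F (k-1) lie in F k, which omega^k kills,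
    and the component conj omega^i tensor conj omega^j is absent by
    [g10_antilin_br]. Antisymmetrizing in (X,Y) turns tensor products into
    wedges. *)
Lemma structure_eq_exists k : (1 <= k <= n)%N ->
  exists A B, structure_eq A B k.
Proof.
case: k => // m kn; have [E dualE] := dual_frame flagF lead_om.
have lemn : (m <= n)%N by lia.
have hk : g10 J (om m.+1) by apply: (adapted_g10 lead_om kn).
have lk := g10_rlin hk.
have br0l' X Y : X \in F m -> om m.+1 (br X Y) = 0.
  move=> Xm; apply: (adapted_kill flagF lead_om kn (leqnn _)).
  by apply: (flag_br flagF).
have br0r' X Y : Y \in F m -> om m.+1 (br X Y) = 0.
  by move=> Ym; rewrite brC (rlinN lk) br0l' ?oppr0.
pose P U Y := lin_part J (fun v => om m.+1 (br v Y)) U.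
pose Q U Y := antilin_part J (fun v => om m.+1 (br v Y)) U.
have lP U : rlinear (P U).
  apply: rlinI => a Y Z; rewrite /P /lin_part !brDr !brZr !(rlinP lk); by field.
have gQ U : g10 J (Q U) by apply: g10_antilin_br.
have P0 U Y : Y \in F m -> P U Y = 0.
  by move=> Ym; rewrite /P /lin_part !br0r' // mulr0 subrr mul0r.
have Q0 U Y : Y \in F m -> Q U Y = 0.
  by move=> Ym; rewrite /Q /antilin_part !br0r' // mulr0 addr0 mul0r.
have omE X Y : om m.+1 (br X Y) = \sum_(1 <= i < m.+1) \sum_(1 <= j < m.+1)
   (om i X * om j Y * lin_part J (P (E i)) (E j)
    + om i X * conjc (om j Y) * antilin_part J (P (E i)) (E j)
    + conjc (om i X) * om j Y * Q (E i) (E j)).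
  rewrite (rlin_expand dualE X lemn (rlin_brl Y lk)); last first.
    by move=> Z Zm; rewrite br0l'.
  apply: eq_bigr => i _.
  rewrite -/(P (E i) Y) -/(Q (E i) Y) (rlin_expand dualE Y lemn (lP _) (P0 _)).
  rewrite (g10_expand dualE Y lemn (gQ _) (Q0 _)).
  rewrite !mulr_sumr -big_split /=; apply: eq_bigr => j _.
  by rewrite /Q; ring.
pose a i j := lin_part J (P (E i)) (E j).
pose b i j := antilin_part J (P (E i)) (E j).
pose c i j := Q (E i) (E j).
exists (fun i j => (a j i - a i j) / 2), (fun i j => (c j i - b i j) / 2).
apply/funext => X; apply/funext => Y; rewrite !fctE !form_sum2E /dCE.
pose W i j := wedge (om i) (fbar (om j)) X Y.
pose f i j := - a i j / 2 * wedge (om i) (om j) X Y.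
transitivity (\sum_(1 <= i < m.+1) \sum_(1 <= j < m.+1)
    (f i j + (- b i j / 2 * W i j + c i j / 2 * W j i))).
  have -> : - om m.+1 (br X Y) = - (om m.+1 (br X Y) - om m.+1 (br Y X)) / 2.
    by rewrite [br Y X]brC (rlinN lk); field.
  rewrite !omE -sumrB -sumrN mulr_suml; apply: eq_bigr => i _.
  rewrite -sumrB -sumrN mulr_suml; apply: eq_bigr => j _.
  by rewrite /f /W /wedge /fbar /a /b /c; field.
have split2 (u v : nat -> nat -> R[i]) :
    \sum_(1 <= i < m.+1) \sum_(1 <= j < m.+1) (u i j + v i j) =
    \sum_(1 <= i < m.+1) \sum_(1 <= j < m.+1) u i j +
    \sum_(1 <= i < m.+1) \sum_(1 <= j < m.+1) v i j.
  by rewrite -big_split; apply: eq_bigr => i _; rewrite -big_split.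
rewrite !split2 sum_square_triangle; last first.
  by move=> i; rewrite /f /wedge; ring.
congr (_ + _).
  apply: eq_bigr => j _; apply: eq_bigr => i _; rewrite /f /wedge.
  by field.
rewrite [X in _ + X]exchange_big -split2 /=.
by apply: eq_bigr => i _; apply: eq_bigr => j _; rewrite /W; field.
Qed.

(** Otherwise omega^k would kill [F (k-2),g], so that F (k-2) would drop two
    steps at once. *)
Lemma structure_eq_nonzero A B k : (2 <= k <= n)%N -> structure_eq A B k ->
  [\/ exists i, (1 <= i < k.-1)%N /\ A i k.-1 <> 0,
      exists j, (1 <= j <= k.-1)%N /\ B k.-1 j <> 0
    | exists i, (1 <= i < k.-1)%N /\ B i k.-1 <> 0].
Proof.
case: k => [|[|k]] // /andP[_ ltkn] eqk; apply: contrapT => no.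
have A0 i : (1 <= i < k.+1)%N -> A i k.+1 = 0.
  by move=> ik; apply: contrapT => nz; apply: no; apply: Or31; exists i.
have B0 j : (1 <= j < k.+2)%N -> B k.+1 j = 0.
  by move=> jk; apply: contrapT => nz; apply: no; apply: Or32; exists j.
have B1 i : (1 <= i < k.+1)%N -> B i k.+1 = 0.
  by move=> ik; apply: contrapT => nz; apply: no; apply: Or33; exists i.
apply: (flag_drop flagF ltkn) => X Xk Y.
have [_ _ w1] := lead_om ltkn; apply: w1.
  by apply: (flag_br flagF) => //; apply: ltnW.
have om0 i : (1 <= i < k.+1)%N -> om i X = 0.
  by move=> ik; apply: (adapted_kill flagF lead_om _ _ Xk); lia.
have := congr1 (fun eta : g -> g -> R[i] => eta X Y) eqk.
rewrite !fctE !form_sum2E /dCE => /eqP; rewrite eqr_oppLR => /eqP ->.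
rewrite [X in - (X + _)]big1_seq ?[X in - (_ + X)]big1_seq ?addr0 ?oppr0 //.
  move=> i; rewrite mem_index_iota => /andP[_ ik].
  rewrite big1_seq // => j; rewrite mem_index_iota => /andP[_ jk].
  have [-> |ni] := eqVneq i k.+1; first by rewrite B0 ?mul0r.
  have [-> |nj] := eqVneq j k.+1; first by rewrite B1 ?mul0r //; lia.
  by rewrite /wedge /fbar !om0 ?rmorph0 ?mul0r ?mulr0 ?subrr ?mulr0 //; lia.
move=> j; rewrite mem_index_iota => /andP[_ jk].
rewrite big1_seq // => i; rewrite mem_index_iota => /andP[_ ij].
have [e|nj] := eqVneq j k.+1; first by rewrite e A0 ?mul0r //; rewrite -e.
by rewrite /wedge !om0 ?mul0r ?mulr0 ?subrr ?mulr0 //; lia.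
Qed.

End Coframe.
End StructureEquations.

(** * Admissible coframes are adapted to the flag *)

Section Admissible.
Variables (R : realType) (g : lieAlgType R) (J : 'End(g)).
Variables (F : nat -> {vspace g}).
Local Notation n := (dimC g).
Hypothesis cJ : complex_structure J.
Hypothesis flagF : complex_flag J n F.
Implicit Types (X Y Z : g) (w u : g -> R[i]) (z : R[i]).
Local Notation L k := (vspace_of (lcs g k)).

Lemma linear_combE (r : seq nat) (c : nat -> R[i]) (om : nat -> g -> R[i]) X :
  (\sum_(k <- r) c k *: om k) X = \sum_(k <- r) c k * om k X.
Proof.
by rewrite (big_morph (fun f : g -> R[i] => f X) (id1 := 0) (op1 := +%R)).
Qed.

Lemma adapted_basis om : adapted J n F om -> basis10 J om.
Proof.
move=> lead_om; have [E dualE] := dual_frame flagF lead_om.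
split=> [k kn|c c0 k kn|al hal]; first exact: adapted_g10 lead_om _ kn.
  have := congr1 (fun f => f (E k)) c0; rewrite linear_combE.
  rewrite (eq_big_nat _ _ (F2 := fun i => c i * (i == k)%:R)) ?sum_delta //.
  by move=> i im; have [_ ->] := dualE _ kn; rewrite // eq_sym.
exists (fun k => al (E k)); apply/funext => X; rewrite linear_combE.
rewrite (g10_expand flagF lead_om dualE X (leqnn n) hal).
  by apply: eq_bigr => i _; rewrite mulrC.
by move=> Y /(flag_bot flagF) ->; apply/rlin0/g10_rlin/hal.
Qed.

(** The common kernels b_k of the first k members satisfy the recursion
    defining the ideals a_k, hence b_k is contained in F k; equality follows
    because b_k / b_(k+1) is at most a complex line. *)
Lemma admissible_adapted om : admissible J om -> adapted J n F om.
Proof.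
case=> [[hom _ span_om] [A [B [Hstr _ _]]]].
pose b k X := forall i, (1 <= i <= k)%N -> om i X = 0.
have bJ k X : (k <= n)%N -> b k X -> b k (J X).
  move=> kn bX i ik; rewrite (g10_J _ (hom i _)) ?bX ?mulr0 //; lia.
have bbr k X Y : (k < n)%N -> b k X -> b k.+1 (br X Y).
  move=> kn bX i ik; have iN : (1 <= i <= n)%N by lia.
  have := congr1 (fun eta : g -> g -> R[i] => eta X Y) (Hstr i iN).
  rewrite !fctE !form_sum2E /dCE => /eqP; rewrite eqr_oppLR => /eqP ->.
  rewrite [X in - (X + _)]big1_seq ?[X in - (_ + X)]big1_seq ?addr0 ?oppr0 //.
    move=> j; rewrite mem_index_iota => /andP[_ jk].
    rewrite big1_seq // => l; rewrite mem_index_iota => /andP[_ lk].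
    by rewrite /wedge /fbar !bX ?rmorph0 ?mul0r ?mulr0 ?subrr ?mulr0 //; lia.
  move=> j; rewrite mem_index_iota => /andP[_ jk].
  rewrite big1_seq // => l; rewrite mem_index_iota => /andP[_ lk].
  by rewrite /wedge !bX ?mul0r ?mulr0 ?subrr ?mulr0 //; lia.
have bn X : b n X -> X = 0.
  move=> bX; apply/eqP/negPn/negP; rewrite -memv0 => X0.
  have [f [_ fX]] := separating_functional X0.
  have [w [hw wRe _]] := g10_real_part cJ f.
  have [c wE] := span_om w hw; case/eqP: fX; rewrite -wRe wE linear_combE.
  rewrite big1_seq // => i; rewrite mem_index_iota => /andP[_ ik].
  by rewrite bX ?mulr0 //; lia.
have bF d k X : (k + d = n)%N -> b k X -> X \in F k.
  elim: d k X => [|d IH] k X; first by rewrite addn0 => -> /bn ->; apply: mem0v.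
  rewrite addnS -addSn => e bX; have ltkn : (k < n)%N by lia.
  apply: (flag_lift flagF ltkn) => Y.
  by split; apply: (IH _ _ e); apply: bbr => //; apply: bJ => //; apply: ltnW.
have Fb k X : (k <= n)%N -> X \in F k -> b k X.
  elim: k X => [|k IH] X ltkn Xk; first by move=> i; lia.
  have bX : b k X by apply: IH; [apply: ltnW | apply: (flag_desc flagF)].
  have hk : g10 J (om k.+1) by apply: hom; lia.
  suff wX : om k.+1 X = 0.
    move=> i /andP[i1]; rewrite leq_eqVlt => /orP[/eqP -> //|ik].
    by apply: bX; lia.
  apply: contrapT => /eqP nz; have [Y Yk] := flag_strict flagF ltkn.
  case/negP; have bY := IH _ (ltnW ltkn) Yk.
  pose z := om k.+1 Y / om k.+1 X.
  have ZF : Y - cscale J z X \in F k.+1.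
    apply: (bF (n - k.+1)%N); first by rewrite subnKC.
    move=> i ik; have hi : g10 J (om i) by apply: hom; lia.
    rewrite (rlinB (g10_rlin hi)) g10_cscale //.
    have [->|ni] := eqVneq i k.+1; first by rewrite mulfVK // subrr.
    by rewrite bX ?bY ?mulr0 ?subr0 //; lia.
  rewrite -[Y](subrK (cscale J z X)) memvD // mem_cscale // => W.
  exact: (flag_J flagF).
move=> j ltjn; split; first by apply: hom; lia.
  by move=> X /(Fb _ _ ltjn) bX; apply: bX; rewrite ltnS leqnn.
move=> X /(Fb _ _ (ltnW ltjn)) bX wX.
apply: (bF (n - j.+1)%N); first by rewrite subnKC.
move=> i /andP[i1]; rewrite leq_eqVlt => /orP[/eqP -> //|ik].
by apply: bX; lia.
Qed.

Lemma Re_eq0 z : z + conjc z = 0 <-> complex.Re z = 0.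
Proof.
case: z => a b; split=> [/eqP|/= ->].
  by rewrite eq_complex /= => /andP[/eqP a0 _]; lra.
by apply/eqP; rewrite eq_complex /= addr0 subrr !eqxx.
Qed.

Lemma condDP (om : nat -> g -> R[i]) k : rlinear (om k) ->
  condD om k <-> forall X, X \in L 1 -> complex.Re (om k X) = 0.
Proof.
move=> lk; split=> [Dk X XL | Re0].
  apply/Re_eq0; move: X XL; apply: (lcs_ind (k := 0)).
    split=> [|a x y /= x0 y0]; first by rewrite rlin0 // rmorph0 addr0.
    rewrite rlinP // rmorphD rmorphM /= oppr0.
    have -> (p q r : R[i]) : p * q + r + (p * conjc q + conjc r)
        = p * (q + conjc q) + (r + conjc r).
      by ring.
    by rewrite x0 y0 mulr0 addr0.
  move=> X Y _ /=; have := congr1 (fun eta : g -> g -> R[i] => eta X Y) Dk.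
  by rewrite !fctE /dCE /fbar -opprD => /eqP; rewrite oppr_eq0 => /eqP.
apply/funext => X; apply/funext => Y; rewrite !fctE /dCE /fbar -opprD.
by rewrite (Re_eq0 _).2 ?oppr0 // Re0 //; apply/br_lcs/mem_lcs0.
Qed.

Section Coframe.
Variable om : nat -> g -> R[i].
Hypothesis lead_om : adapted J n F om.

(** On a covered line, omega would take the value 1 on L 1. *)
Lemma condD_not_covers j : (j < n)%N -> condD om j.+1 -> ~ covers F (L 1) j.
Proof.
move=> ltjn Dj /coversP cov; have lj := lead_om ltjn; case: (lj) => hj w0 _.
have [X Xj wX] := lead_value flagF 1 ltjn lj.
have [Z ZL XZ] := cov X Xj.
have := (condDP (g10_rlin hj)).1 Dj Z ZL.
rewrite -(subKr X Z) (rlinB (g10_rlin hj)) wX (w0 _ XZ) subr0 /= => /eqP.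
by rewrite oner_eq0.
Qed.

(** A relation a d omega + b d conj omega in the span of the earlier
    differentials says that a omega + b conj omega agrees on L 1 with a form
    killing F j. On a covered line omega takes every complex value z on
    L 1 meet F j, so that a z + b conj z = 0 for all z. *)
Lemma covers_condI j : (j < n)%N -> covers F (L 1) j -> condI om j.+1.
Proof.
move=> ltjn /coversP cov a b; split=> [span_ab|[-> ->]]; last first.
  by rewrite !scale0r addr0; apply: (subspace_span _).1.
have lj := lead_om ltjn; case: (lj) => hj w0 _.
have [v [lv vE vF]] : exists v : g -> R[i],
    [/\ rlinear v, a *: dCE (om j.+1) + b *: dCE (fbar (om j.+1)) = dCE v
      & forall X, X \in F j -> v X = 0].
  apply: (span_sub (P := [set eta : g -> g -> R[i] | exists v : g -> R[i],
    [/\ rlinear v, eta = dCE v & forall X, X \in F j -> v X = 0]]%classic)) span_ab.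
    split=> [|c x y [v [lv -> vF]] [v' [lv' -> vF']]].
      exists 0; split=> //; first exact: rlin_zero.
      by apply/funext => X; apply/funext => Y; rewrite /dCE oppr0.
    exists (c *: v + v'); split=> [|| X Xj].
    - exact/rlin_add/lv'/rlin_scale/lv.
    - by apply/funext => X; apply/funext => Y; rewrite !fctE /dCE scalerN opprD.
    - by rewrite !fctE vF // vF' // scaler0 addr0.
  move=> eta [i [ij e]]; have ijn : (1 <= i <= n)%N by move: ij => /=; lia.
  have li := g10_rlin (adapted_g10 lead_om ijn).
  have i0 X : X \in F j -> om i X = 0.
    by move=> Xj; apply: (adapted_kill flagF lead_om ijn _ Xj); move: ij => /=; lia.
  case: e => ->; first by exists (om i).
  exists (fbar (om i)); split=> // [|X /i0]; first exact: rlin_fbar.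
  by rewrite /fbar => ->; rewrite rmorph0.
pose psi := a *: om j.+1 + b *: fbar (om j.+1).
have lpsi : rlinear psi.
  have lw := g10_rlin hj.
  by apply: rlin_add; apply: rlin_scale => //; apply: rlin_fbar.
have psi_v Z : Z \in L 1 -> psi Z = v Z.
  move=> ZL; apply/eqP; rewrite -subr_eq0; apply/eqP.
  have ldif : rlinear (fun X => psi X - v X).
    by apply: rlinI => c X Y; rewrite !rlinP // mulrBr opprD addrACA.
  apply: (lcs_ind (k := 0) (subspace_rker ldif) _ ZL) => X Y _ /=.
  have := congr1 (fun eta : g -> g -> R[i] => eta X Y) vE.
  rewrite /psi !fctE /dCE => /(congr1 -%R); rewrite opprK => <-.
  by rewrite !scalerN -opprD opprK subrr.
have val z : a * z + b * conjc z = 0.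
  have [X Xj wX] := lead_value flagF z ltjn lj.
  have [Z ZL XZ] := cov X Xj.
  have Zj : Z \in F j by rewrite -(subKr X Z) memvB //; apply: (flag_desc flagF).
  have wZ : om j.+1 Z = z.
    by rewrite -(subKr X Z) (rlinB (g10_rlin hj)) (w0 _ XZ) subr0.
  by have := psi_v Z ZL; rewrite vF // /psi !fctE /fbar wZ.
have := val 1; have := val 'i%C.
rewrite rmorph1 !mulr1.
have -> : conjc 'i%C = - 'i%C :> R[i].
  by apply/eqP; rewrite eq_complex /= oppr0 !eqxx.
rewrite mulrN -mulrBl => /eqP; rewrite mulf_eq0 => /orP[|]; last first.
  by rewrite eq_complex /= oner_eq0 andbF.
rewrite subr_eq0 => /eqP -> /eqP; rewrite -mulr2n mulrn_eq0 /= => /eqP b0.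
by rewrite b0.
Qed.
End Coframe.
End Admissible.

(** * A coframe normalized against V^2 *)

Section SpecialCoframe.
Variables (R : realType) (g : lieAlgType R) (J : 'End(g)).
Variables (F : nat -> {vspace g}).
Local Notation n := (dimC g).
Hypothesis cJ : complex_structure J.
Hypothesis flagF : complex_flag J n F.
Hypothesis L3 : lcs g 3 = [set 0]%classic.
Hypothesis n5 : (5 <= n)%N.
Implicit Types (X Y Z : g) (w u : g -> R[i]) (z : R[i]).
Local Notation L k := (vspace_of (lcs g k)).

(** A (1,0)-form kills L 2 as soon as its real part kills L 2 and J L 2, so it
    suffices that L 2 + J L 2 misses the j-th line. If Z + JZ' lies in F j
    with Z, Z' in L 2, then both are in F j by [lcs2_J_independent], hence in
    F (j+1) because L 2 misses a covered line. *)
Lemma lead_killing_lcs2 j : (j.+2 < n)%N -> covers F (L 1) j ->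
  exists w, leads J F j w /\ forall Z, Z \in L 2 -> w Z = 0.
Proof.
move=> ltjn cov; have ltn : (j < n)%N by lia.
have [X Xj Xj1] := flag_strict flagF ltn.
have XU : X \notin (L 2 + J @: L 2 + F j.+1)%VS.
  apply/negP => /memv_addP[_ /memv_addP[Z ZL [_ /memv_imgP[Z' ZL' ->] ->]]].
  case=> W Wj eX.
  have ZJ : Z + J Z' \in F j.
    by rewrite -(addrK W (Z + J Z')) -eX memvB //; apply: (flag_desc flagF).
  have [Zj Zj'] := lcs2_J_independent flagF L3 ltn ZL ZL' ZJ.
  have miss V : V \in L 2 -> V \in F j -> V \in F j.+1.
    exact: (lcs2_misses_covered cJ flagF L3 ltjn cov).
  case/negP: Xj1; rewrite eX memvD // memvD //; first exact: miss.
  by apply: (flag_J flagF); apply: miss.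
have [|w [lw Re0]] := lead_exists cJ flagF ltn Xj XU.
  by move=> Y Yj; apply: (subvP (addvSr _ _)).
exists w; split=> // Z ZL; have [hw _ _] := lw.
have LU V : V \in (L 2 + J @: L 2)%VS -> V \in (L 2 + J @: L 2 + F j.+1)%VS.
  exact: (subvP (addvSl _ _)).
have := Re0 Z (LU _ (subvP (addvSl _ _) _ ZL)).
have := Re0 (J Z) (LU _ (subvP (addvSr _ _) _ (memv_img J ZL))).
rewrite g10_J //; case: (w Z) => p q /= Rq Rp; apply/eqP; rewrite eq_complex /=.
by rewrite Rp eqxx /=; apply/eqP; lra.
Qed.

Lemma lead_Re_killing_lcs1 j : (j < n)%N -> ~ covers F (L 1) j ->
  exists w, leads J F j w /\ forall Z, Z \in L 1 -> complex.Re (w Z) = 0.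
Proof.
move=> ltjn /negP/subvPn[X Xj XU].
have [|w [lw Re0]] := lead_exists cJ flagF ltjn Xj XU.
  by move=> Y; apply: (subvP (addvSr _ _)).
by exists w; split=> // Z ZL; apply: Re0; apply: (subvP (addvSl _ _)).
Qed.

Lemma leads_scale j z w : z != 0 -> leads J F j w -> leads J F j (z *: w).
Proof.
move=> z0 [hw w0 w1]; split=> [|X /w0 wX|X Xj]; first exact: g10_scale.
  by rewrite scalefE wX mulr0.
by rewrite scalefE => /eqP; rewrite mulf_eq0 (negbTE z0) => /eqP /(w1 _ Xj).
Qed.

(** Killing L 2 is asked up to n - 2 only: on the last two lines, L 2 may be
    present even if L 1 covers them. *)
Record normal_coframe (om : nat -> g -> R[i]) : Prop := NormalCoframe {
  normal_adapted : adapted J n F om;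
  normal_condD : forall k, (3 <= k <= n)%N ->
    ~ covers F (L 1) k.-1 -> condD om k;
  normal_kills : forall k, (3 <= k <= n - 2)%N -> covers F (L 1) k.-1 ->
    forall Z, Z \in L 2 -> om k Z = 0;
  normal_d2 : dCE (om 2%N) = wedge (om 1%N) (fbar (om 1%N))
}.

Lemma normal_coframe_exists : exists om, normal_coframe om.
Proof.
have /choice[w Hw] : forall j, exists w, (j < n)%N -> [/\ leads J F j w,
    ~ covers F (L 1) j -> forall Z, Z \in L 1 -> complex.Re (w Z) = 0
  & covers F (L 1) j -> (j.+2 < n)%N -> forall Z, Z \in L 2 -> w Z = 0].
  move=> j; have [ltjn|le] := ltnP j n; last first.
    by exists 0.
  have [cov|ncov] := EM (covers F (L 1) j); last first.
    by have [w [lw wL]] := lead_Re_killing_lcs1 ltjn ncov; exists w.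
  have [ltj2|lej] := ltnP j.+2 n.
    by have [w [lw wL]] := lead_killing_lcs2 ltj2 cov; exists w.
  have [X Xj Xj1] := flag_strict flagF ltjn.
  by have [//|w [lw _]] := lead_exists cJ flagF ltjn Xj Xj1; exists w.
pose om1 k := w k.-1.
have lead1 : adapted J n F om1 by move=> j /Hw[].
have n2 : (1 <= 2 <= n)%N by lia.
have [A [B eq2]] := structure_eq_exists cJ flagF lead1 n2.
have B0 : B 1%N 1%N != 0.
  apply/eqP => B0; have := structure_eq_nonzero flagF lead1 _ eq2.
  case=> [|[i [i1 _]]|[j [j1]]|[i [i1 _]]].
  - by lia.
  - by move: i1; lia.
  - by have -> : j = 1%N by move: j1 => /=; lia.
  - by move: i1; lia.
pose om k := if k == 2 then (B 1%N 1%N)^-1 *: om1 2 else om1 k.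
exists om; split.
- move=> j ltjn; rewrite /om; case: eqP => [[->]|_]; last exact: lead1.
  by apply: leads_scale; rewrite ?invr_eq0 //; apply: lead1; lia.
- move=> [|[|[|k]]] // kn ncov; have ltkn : (k.+2 < n)%N by lia.
  have [[hw _ _] Re0 _] := Hw _ ltkn.
  exact/(condDP (om := om) (k := k.+3) (g10_rlin hw))/Re0.
- move=> [|[|[|k]]] // kn cov; have ltkn : (k.+2 < n)%N by lia.
  by have [_ _ L20] := Hw _ ltkn; apply: L20 => //; lia.
(* For k = 2 the structure equation has the single term B 1 1. *)
rewrite /om /=; apply/funext => X; apply/funext => Y.
have := congr1 (fun eta : g -> g -> R[i] => eta X Y) eq2.
rewrite !fctE !form_sum2E /dCE big_nat1 big_geq // add0r !big_nat1 => eqXY.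
rewrite [LHS](_ : _ = - ((B 1 1)^-1 * om1 2 (br X Y)))%N //.
by rewrite -mulrN eqXY mulKf.
Qed.

Variable om : nat -> g -> R[i].
Hypothesis normal_om : normal_coframe om.
Local Notation lead_om := (normal_adapted normal_om).

Lemma om1_closed : dCE (om 1%N) = 0.
Proof.
apply/funext => X; apply/funext => Y; rewrite /dCE.
rewrite (adapted_kill flagF lead_om (j := 1)) ?oppr0 //; first by lia.
by apply: (flag_br flagF); [lia | apply: (flag_top flagF)].
Qed.

Lemma om_admissible : admissible J om.
Proof.
split; first exact: adapted_basis flagF _ lead_om.
have /choice[A /choice[B HAB]] : forall k, exists A, exists B,
    (1 <= k <= n)%N -> structure_eq om A B k.
  move=> k; have [kn|nkn] := boolP (1 <= k <= n)%N; last first.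
    by exists (fun _ _ => 0), (fun _ _ => 0).
  by have [A [B e]] := structure_eq_exists cJ flagF lead_om kn; exists A, B.
exists A, B; split=> [|k kn|k kn]; first exact: HAB.
  by apply: (structure_eq_nonzero flagF lead_om kn); apply: HAB; lia.
have [->|k1] := eqVneq k 1%N.
  left; apply/condDP; first by apply/g10_rlin/(adapted_g10 lead_om); lia.
  move=> X XL; rewrite (adapted_kill flagF lead_om (j := 1)) //; first by lia.
  by apply: (lcs_flag flagF) => //; lia.
have [->|k2] := eqVneq k 2%N.
  left; apply/funext => X; apply/funext => Y.
  have /(congr1 (fun eta : g -> g -> R[i] => eta X Y)) := normal_d2 normal_om.
  rewrite !fctE /dCE {2}/fbar -rmorphN => ->.
  rewrite /wedge /fbar rmorphB !rmorphM /= !conjcK.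
  by ring.
have [cov|ncov] := EM (covers F (L 1) k.-1).
  right; case: k kn k1 k2 cov => // k kn k1 k2 cov.
  by apply: (covers_condI flagF lead_om) => //; lia.
by left; apply: (normal_condD normal_om) => //; lia.
Qed.

(** All admissible coframes are adapted to the same flag, so that condition (D)
    on one of them says the same about the flag. *)
Lemma DptP k : (3 <= k <= n)%N -> Dpt J k <-> ~ covers F (L 1) k.-1.
Proof.
move=> kn; split=> [[_ [om' [adm D']]]|ncov].
  case: k kn D' => // k kn D'.
  by apply: (condD_not_covers flagF (admissible_adapted cJ flagF adm)) => //; lia.
split; first by lia.
by exists om; split; [apply: om_admissible | apply: (normal_condD normal_om)].
Qed.

Lemma om_kills_lcs2 k Z : (1 <= k <= n - 2)%N -> ~ ((3 <= k)%N /\ Dpt J k) ->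
  Z \in L 2 -> om k Z = 0.
Proof.
move=> kn nD ZL; have [k3|k3] := leqP 3 k.
  apply: (normal_kills normal_om) => //; first by lia.
  apply: contrapT => ncov; apply: nD; split=> //; apply/DptP => //; lia.
apply: (adapted_kill flagF lead_om (j := 2)); [lia | lia |].
by apply: (lcs_flag flagF) => //; lia.
Qed.

Lemma Dpt_meets_lcs2 k : (3 <= k <= n - 2)%N -> Dpt J k ->
  exists Z, [/\ Z \in L 2, Z \in F k.-1 & om k Z != 0].
Proof.
move=> kn /DptP ncov; case: k kn ncov => [|[|[|k]]] // kn ncov.
have ltkn : (k.+2 < n)%N by lia.
have [|Z [ZL Zk] Zk1] := uncovered_meets_lcs2 cJ flagF ltkn.
  by apply: ncov; lia.
exists Z; split=> //; have [_ _ w1] := lead_om ltkn.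
by apply: contraNneq Zk1; apply: w1.
Qed.

Lemma Dpt_Re k Z : (3 <= k <= n)%N -> Dpt J k -> Z \in L 2 ->
  om k Z + conjc (om k Z) = 0.
Proof.
move=> kn /(DptP kn)/(normal_condD normal_om kn) Dk ZL; apply/Re_eq0.
have lk : rlinear (om k) by apply/g10_rlin/(adapted_g10 lead_om); lia.
by apply: (condDP lk).1 => //; apply: lcs_desc.
Qed.

Lemma om_in_V2 k : (3 <= k <= n - 2)%N -> VkC g 2 (om k) <-> ~ Dpt J k.
Proof.
move=> kn; have lk : rlinear (om k) by apply/g10_rlin/(adapted_g10 lead_om); lia.
split=> [/VkCP[_ kill] Dk | nD].
  by have [Z [ZL _ /eqP]] := Dpt_meets_lcs2 kn Dk; apply; apply: kill.
by apply/VkCP; split=> // Z; apply: om_kills_lcs2; [lia | case].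
Qed.

Lemma om_in_V3 k : (1 <= k <= n)%N -> VkC g 3 (om k).
Proof.
move=> kn; have lk : rlinear (om k) by apply/g10_rlin/(adapted_g10 lead_om).
by apply/VkCP; split=> // X /mem_lcs; rewrite L3 => ->; apply: rlin0.
Qed.

Lemma combination_in_V2 (a b : nat -> R[i]) :
  VkC g 2 (\sum_(1 <= k < (n - 2).+1) (a k *: om k + b k *: fbar (om k))) <->
  (forall k, Dpt J k -> (3 <= k <= n - 2)%N -> a k = b k).
Proof.
pose t X k := a k * om k X + b k * conjc (om k X).
have tE X : (\sum_(1 <= k < (n - 2).+1) (a k *: om k + b k *: fbar (om k))) X
    = \sum_(1 <= k < (n - 2).+1) t X k.
  by rewrite (big_morph (fun f : g -> R[i] => f X) (id1 := 0) (op1 := +%R)).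
have lsum : rlinear
    (\sum_(1 <= k < (n - 2).+1) (a k *: om k + b k *: fbar (om k))).
  rewrite big_nat; apply: big_ind => [|w u|k kn].
  - exact: rlin_zero.
  - exact: rlin_add.
  have lk : rlinear (om k) by apply/g10_rlin/(adapted_g10 lead_om); lia.
  by apply: rlin_add; apply: rlin_scale => //; apply: rlin_fbar.
have t0 X k : X \in L 2 -> (1 <= k <= n - 2)%N ->
    ((3 <= k)%N -> Dpt J k -> a k = b k) -> t X k = 0.
  move=> XL kn ab; have [[k3 Dk]|nD] := EM ((3 <= k)%N /\ Dpt J k).
    by rewrite /t ab // -mulrDr Dpt_Re ?mulr0 //; lia.
  by rewrite /t om_kills_lcs2 // rmorph0 !mulr0 addr0.
split=> [/VkCP[_ kill] | ab]; last first.
  apply/VkCP; split=> // X XL; rewrite tE big1_seq // => k.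
  rewrite mem_index_iota => /andP[_ kn]; apply: t0 => // k3 Dk.
  by apply: ab => //; lia.
(* Downward induction on k: on a vector of L 2 in F (k-1) which omega^k does not
   kill, the terms below k vanish by degree and those above k by induction. *)
suff H d k : k = (n - 2 - d)%N -> Dpt J k -> (3 <= k <= n - 2)%N -> a k = b k.
  by move=> k Dk kn; apply: (H (n - 2 - k)%N) => //; lia.
elim/ltn_ind: d k => d IH k ek Dk kn.
have [Z [ZL Zk wZ]] := Dpt_meets_lcs2 kn Dk.
have kI : (1 <= k < (n - 2).+1)%N by lia.
have := kill Z ZL; rewrite tE (bigD1_seq k) ?iota_uniq ?mem_index_iota //=.
rewrite big1_seq ?addr0 => [tk | i /andP[nik]]; last first.
  rewrite mem_index_iota => ik; have [leik|ltki] := leqP i k.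
    have ltik : (i <= k.-1)%N by lia.
    by rewrite /t (adapted_kill flagF lead_om _ ltik Zk) ?rmorph0 ?mulr0 ?addr0 //; lia.
  apply: t0 => // i3 Di.
  by apply: (IH (n - 2 - i)%N) => //; lia.
have kn' : (3 <= k <= n)%N by lia.
have /eqP := Dpt_Re kn' Dk ZL; rewrite addrC addr_eq0 => /eqP wE.
move: tk; rewrite /t wE mulrN -mulrBl => /eqP.
by rewrite mulf_eq0 (negbTE wZ) orbF subr_eq0 => /eqP.
Qed.
End SpecialCoframe.

(** * Parity and the theorem *)

Lemma alternating_parity (P : nat -> Prop) m :
  (forall k, (3 <= k < m)%N -> (P k.+1 <-> ~ P k)) ->
  forall k, (3 <= k <= m)%N -> (P k <-> (k = m %[mod 2] <-> P m)).
Proof.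
move=> alt k km.
suff H : forall e, (e <= m - 3)%N ->
    (P (m - e)%N <-> (m - e = m %[mod 2] <-> P m)).
  by have := H (m - k)%N; rewrite subKn; [apply|]; lia.
elim=> [|e IH] le; first by rewrite subn0; tauto.
have {}IH := IH (ltnW le).
have rng : (3 <= m - e.+1 < m)%N by lia.
have := alt _ rng; rewrite subnSK; last by lia.
have par : (m - e.+1 = m %[mod 2]) <-> ~ (m - e = m %[mod 2]) by lia.
have := EM (P m); have := EM (P (m - e.+1)%N).
by have := EM (m - e = m %[mod 2]); tauto.
Qed.

Theorem theorem1p13 (R : realType) (g : lieAlgType R) (J : 'End(g)) (n : nat)
    (hJ : MaxN J) (hnu : is_lie_step g 3) (hdim : dimC g = n)
    (hn : (5 <= n)%N) :
  [/\ Dpt J (n - 2)%N ->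
        forall k : nat, (3 <= k <= n - 2)%N ->
          (Dpt J k <-> k = n - 2 %[mod 2]),
      ~ Dpt J (n - 2)%N ->
        forall k : nat, (3 <= k <= n - 2)%N ->
          (Dpt J k <-> k <> n - 2 %[mod 2])
    & exists om : nat -> g -> R[i],
        [/\ admissible J om,
            dCE (om 1%N) = 0,
            dCE (om 2%N) = wedge (om 1%N) (fbar (om 1%N)),
            forall k : nat, (3 <= k <= n - 2)%N ->
              (~ Dpt J k <-> VkC g 2 (om k)) /\
              (Dpt J k <-> VkC g 3 (om k) /\ ~ VkC g 2 (om k))
          & forall a b : nat -> R[i],
              VkC g 2 (\sum_(1 <= k < (n - 2).+1)
                         (a k *: om k + b k *: fbar (om k)))
              <-> (forall k : nat, Dpt J k -> (3 <= k <= n - 2)%N ->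
                     a k = b k)]].
Proof.
subst n; case: hJ => _ cJ _ stepJ; case: hnu => L3 _.
have flagF := complex_flag_ak cJ stepJ.
have [om nom] := normal_coframe_exists cJ flagF L3 hn.
have DP := DptP cJ flagF hn nom.
have alt k : (3 <= k < dimC g - 2)%N -> (Dpt J k.+1 <-> ~ Dpt J k).
  move=> kn; rewrite DP ?DP; [|lia|lia].
  case: k kn => [|[|[|k]]] // kn /=.
  have lt : (k + 5 < dimC g)%N by lia.
  have := covers_alternate cJ flagF L3 lt.
  set c2 := covers _ _ k.+2; set c3 := covers _ _ k.+3.
  by have := EM c2; have := EM c3; tauto.
have par := alternating_parity alt.
split=> [Dn k /par|nDn k /par|]; [tauto | tauto |].
exists om; split=> [|||k kn|a b].
- exact: (om_admissible cJ flagF hn nom).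
- exact: (om1_closed flagF hn nom).
- exact: (normal_d2 nom).
- have V2 := om_in_V2 cJ flagF hn nom kn.
  have V3 : VkC g 3 (om k) by apply: (om_in_V3 L3 nom); lia.
  by have [|] := EM (Dpt J k); tauto.
- exact: (combination_in_V2 cJ flagF hn nom).
Qed.
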